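(* Let $\Gamma$ be a finite simple graph (a finite simplicial complex of dimension at most $1$) with at least one edge, let $|E(\Gamma)|$ be its number of edges, and let $d(\Gamma)$ be the maximum degree of a vertex in the Hasse diagram $\mathcal{H}(\Gamma)$. Then the Morse complex $\mathcal{M}(\Gamma)$ is $\left(\left\lceil\frac{|E(\Gamma)|}{d(\Gamma)}\right\rceil-2\right)$-connected. In particular, $\mathcal{M}(\Gamma)$ is connected once $|E(\Gamma)|>d(\Gamma)$, simply connected once $|E(\Gamma)|>2d(\Gamma)$, and, for every integer $m\ge 1$, $(m-1)$-connected once $|E(\Gamma)|>m\cdot d(\Gamma)$.
   Context: For a finite abstract simplicial complex $\Delta$ (simplices are non-empty; $\sigma^{(p)}$ indicates $\dim\sigma=p$), the Hasse diagram $\mathcal{H}(\Delta)$ is the simple graph with a vertex for each simplex of $\Delta$ and an edge between two simplices whenever one is a codimension-$1$ face of the other. A primitive discrete vector field on $\Delta$ is a pair $(\sigma^{(p)},\tau^{(p+1)})$ of simplices with $\sigma<\tau$. A discrete vector field $V$ on $\Delta$ is a collection of primitive discrete vector fields such that each simplex of $\Delta$ occurs in at most one pair of $V$. A $V$-path is a sequence of simplices $\sigma_0^{(p)},\tau_0^{(p+1)},\sigma_1^{(p)},\dots,\tau_{m-1}^{(p+1)},\sigma_m^{(p)}$ such that for each $0\le i\le m-1$ we have $(\sigma_i,\tau_i)\in V$ and $\tau_i>\sigma_{i+1}\ne\sigma_i$. A $V$-cycle is a $V$-path with $m>0$ and $\sigma_m=\sigma_0$. $V$ is acyclic if there are no $V$-cycles.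 The Morse complex $\mathcal{M}(\Delta)$ is the simplicial complex whose simplices are the non-empty acyclic discrete vector fields on $\Delta$, with face relation given by inclusion. A space is $n$-connected if it is non-empty and its homotopy groups $\pi_k$ vanish for all $0\le k\le n$; $(-1)$-connected means non-empty, and being $n$-connected for $n\le -2$ is a vacuous condition. *)

(* Defs.v *)
From mathcomp Require Import all_boot boolp.

Set Implicit Arguments.
Unset Strict Implicit.
Unset Printing Implicit Defensive.

(* The vertices of a complex on T are the x with [set x] in it; they need not
   exhaust T.  The dimension of a simplex s is #|s| - 1. *)
Record complex (T : finType) := Complex {
  simplices :> {set {set T}};
  simplex_neq0 : set0 \notin simplices;
  simplex_face : forall s t : {set T},
    t \in simplices -> s \subset t -> s != set0 -> s \in simplices }.

Section MorseComplex.
Variables (T : finType) (K : complex T).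
Implicit Types (s t : {set T}) (V W : {set {set T} * {set T}}).

(* Codimension-1 faces. *)
Definition facet s t : bool := (s \subset t) && (#|t| == #|s|.+1).

Definition hasse : rel {set T} :=
  fun s t => [&& s \in K, t \in K & facet s t || facet t s].

Definition hasse_degree s : nat := #|[set t in K | hasse s t]|.

Definition max_hasse_degree : nat := \max_(s in K) hasse_degree s.

Definition primitive_vector_field (q : {set T} * {set T}) : bool :=
  [&& q.1 \in K, q.2 \in K & facet q.1 q.2].

Definition discrete_vector_field V : Prop :=
  (forall q, q \in V -> primitive_vector_field q) /\
  (forall s, s \in K -> #|[set q in V | (s == q.1) || (s == q.2)]| <= 1).

(* The path s_0, t_0, s_1, ..., t_(m-1), s_m is encoded by its origin s_0 and
   the list [:: (t_0, s_1); ...; (t_(m-1), s_m)]. *)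
Fixpoint vpath V s (p : seq ({set T} * {set T})) : bool :=
  (s \in K) &&
  (if p is (t, s') :: p' then
     [&& (s, t) \in V, facet s' t, s' != s & vpath V s' p']
   else true).

Definition vcycle V s (p : seq ({set T} * {set T})) : bool :=
  [&& 0 < size p, vpath V s p & last s (unzip2 p) == s].

Definition acyclic V : Prop := forall s p, ~~ vcycle V s p.

Definition morse_simplices : {set {set {set T} * {set T}}} :=
  [set V | `[< [/\ V != set0, discrete_vector_field V & acyclic V] >]].

Lemma morse_simplex_neq0 : set0 \notin morse_simplices.
Proof. by rewrite inE; apply/asboolP => -[]; rewrite eqxx. Qed.

Lemma vpath_subset V W s p : V \subset W -> vpath V s p -> vpath W s p.
Proof.
move=> VW; elim: p s => [//|[t s'] p IHp] s /= /andP[-> /and4P[sV -> -> Vp]].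
by rewrite (subsetP VW _ sV) IHp.
Qed.

Lemma morse_simplex_face V W : W \in morse_simplices -> V \subset W ->
  V != set0 -> V \in morse_simplices.
Proof.
rewrite !inE => /asboolP[_ [Wprim Wdis] Wacy] VW V0; apply/asboolP; split=> //.
  split=> [q /(subsetP VW) /Wprim //|s sK].
  apply: leq_trans (Wdis s sK); apply/subset_leq_card/subsetP => q.
  by rewrite !inE => /andP[/(subsetP VW) -> ->].
move=> s p; apply: contra (Wacy s p) => /and3P[p0 Vp lastp].
by apply/and3P; split=> //; exact: vpath_subset Vp.
Qed.

Definition morse_complex : complex ({set T} * {set T})%type :=
  Complex morse_simplex_neq0 morse_simplex_face.

End MorseComplex.

Definition is_graph (T : finType) (K : complex T) : Prop :=
  forall s, s \in K -> #|s| <= 2.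

Definition nb_edges (T : finType) (K : complex T) : nat :=
  #|[set s in K | #|s| == 2]|.

From mathcomp Require Import all_boot all_order all_algebra.
From mathcomp Require Import all_classical all_reals all_analysis.
Import Order.TTheory GRing.Theory Num.Theory.
Import numFieldNormedType.Exports.

(* From here on set0, [set x | P] and the like denote classical sets. *)
Local Open Scope classical_set_scope.
Local Open Scope ring_scope.

(* Points in barycentric coordinates.  Used as a type, this set carries the
   subspace topology of the finite product R^T. *)
Definition realization (R : realType) (T : finType) (K : complex T) :
    set {ptws T -> R} :=
  [set x | (forall v, 0 <= x v) /\ \sum_(v : T) x v = 1 /\
           finset (fun v => x v != 0) \in K].
Arguments realization R {T} K.

Section Homotopy.
Variables (R : realType) (X : topologicalType).

Definition cube (k : nat) : set 'rV[R]_k :=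
  [set x | forall i, 0 <= x ord0 i <= 1].

Definition cube_boundary (k : nat) : set 'rV[R]_k :=
  [set x | cube x /\ exists i, x ord0 i = 0 \/ x ord0 i = 1].

(* Representatives of the elements of pi_k(X, x0).  Only their values on the
   cube are meaningful. *)
Definition spheroid (k : nat) (x0 : X) (f : 'rV[R]_k -> X) : Prop :=
  {within @cube k, continuous f} /\
  (forall x, cube_boundary x -> f x = x0).

Definition homotopic (k : nat) (x0 : X) (f g : 'rV[R]_k -> X) : Prop :=
  exists H : 'rV[R]_k * R -> X,
    [/\ {within @cube k `*` `[0, 1], continuous H},
        (forall x, cube x -> H (x, 0) = f x),
        (forall x, cube x -> H (x, 1) = g x) &
        (forall x t, cube_boundary x -> 0 <= t <= 1 -> H (x, t) = x0)].

(* For k = 0 the cube is a point and its boundary is empty, so that this says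
   that the pointed set pi_0(X, x0) has a single element. *)
Definition pi_trivial (k : nat) (x0 : X) : Prop :=
  forall f : 'rV[R]_k -> X, spheroid x0 f -> homotopic x0 f (cst x0).

Definition n_connected (n : int) : Prop :=
  (-1 <= n -> exists x : X, True) /\
  (forall k : nat, k%:Z <= n -> forall x0 : X, pi_trivial k x0).

Definition path_connected : Prop :=
  (exists x : X, True) /\
  (forall x y : X, exists f : R -> X,
     [/\ {within `[0, 1], continuous f}, f 0 = x & f 1 = y]).

Definition simply_connected : Prop :=
  path_connected /\ (forall x0 : X, pi_trivial 1 x0).

End Homotopy.

(* Main.v *)
Require Import Defs.
From mathcomp Require Import all_boot boolp.

(** In a graph, acyclic vector fields are oriented forests: each arc [(v, e)]
    directs the edge [e] away from its tail [v].  Let [B] be the acyclic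
    orientation of all the edges that follows a linear order on the vertices.
    For a forest [F], let [B_F] be the set of the arcs of [B] that touch no tail
    of [F]; adding one arc to [F] removes at most [d] arcs from [B_F], where [d]
    bounds the degrees.  For [A] containing [B_F], the part in [A] of the link
    of [F] is
    [(m - 2)]-connected as soon as [(m - 1) * d < #|B_F|].  One inducts on [m]
    and adds the arcs of [A] outside [B_F] one at a time: each step glues a cone
    over a link to which the induction hypothesis applies with [m - 1].  For
    [A = B_F] the complex is the join of the discrete sets of arcs with a given
    tail, and there are at least [#|B_F| / d >= m] of these.

    Connectivity is handled as the possibility of extending maps from the
    boundary of a box to the box.  For a union of two open sets, the box is cut
    into small cells and the map is extended cell after cell, those lying between
    the two open sets being sent to their intersection. *)

Set Implicit Arguments.
Unset Strict Implicit.
Unset Printing Implicit Defensive.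

(** * Forests of a graph *)

Section Forests.
Variables (T : finType) (G : complex T).
Hypothesis Ggraph : is_graph G.
Local Notation arc := ({set T} * {set T})%type.
Implicit Types (q : arc) (F W : {set arc}) (v s t : {set T}).

Definition arc_tail q : {set T} := q.1.
(** The endpoint of the edge opposite to the tail, kept as a singleton so that it is again a simplex
    of [G]. *)
Definition arc_head q : {set T} := q.2 :\: q.1.

(** Unlike a simplex of the Morse complex, a forest may be empty; the empty forest is where the
    induction on links starts. *)
Definition forest F : bool := `[< discrete_vector_field G F /\ acyclic G F >].

(** An arbitrary linear order on the vertices, taken from the enumeration of the finite type. *)
Definition arc_rank s : nat := enum_rank s.

(** The orientation [B] of the overview; its subset [B_F] is [free_arcs F]. *)
Definition upward : {set arc} :=
  [set q | primitive_vector_field G q &&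
           (arc_rank (arc_tail q) < arc_rank (arc_head q))].

Definition free_arcs F : {set arc} :=
  [set q in upward |
     (arc_tail q \notin arc_tail @: F) && (arc_head q \notin arc_tail @: F)].

Lemma primitive_card q : primitive_vector_field G q -> #|q.1| = 1 /\ #|q.2| = 2.
Proof.
move=> /and3P[q1 q2 /andP[_ /eqP c2]].
have : 0 < #|q.1|.
  rewrite card_gt0; apply: contraTneq q1 => ->; exact: simplex_neq0.
by have := Ggraph q2; rewrite c2; case: #|q.1| => [|[|]].
Qed.

(** An edge has only two endpoints, so a path entering an edge at one of them must leave at the
    other. *)
Lemma facet_edge s s' t : #|t| = 2 -> facet s t -> facet s' t -> s' != s ->
  s' = t :\: s.
Proof.
move=> t2 /andP[st /eqP s1] /andP[s't /eqP s'1] s's.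
move: s1 s'1; rewrite t2 => -[s1] [s'1].
have /cards1P[x s'x] : #|s'| == 1 by rewrite -s'1.
apply/eqP; rewrite eqEcard cardsD (setIidPr st) t2 -s1 -s'1 andbT.
rewrite subsetD s't s'x disjoints1; apply: contra s's => xs.
by rewrite eqEcard s'x sub1set xs cards1 -s1.
Qed.

Lemma primitive_head q : primitive_vector_field G q ->
  arc_head q \in G /\ arc_head q != arc_tail q.
Proof.
move=> pq; have [c1 c2] := primitive_card pq; case/and3P: pq => q1 q2 /andP[sq _].
have ch : #|arc_head q| = 1 by rewrite cardsD (setIidPr sq) c1 c2.
have h0 : arc_head q != set0 by rewrite -card_gt0 ch.
split; first by apply: simplex_face q2 _ h0; exact: subsetDl.
apply: contra_neq h0 => hq; apply/setP => x; rewrite [RHS]inE.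
have : (x \in arc_head q) = (x \in q.1) by rewrite hq.
by rewrite /arc_head !inE; case: (x \in q.1).
Qed.

Lemma upward_primitive q : q \in upward -> primitive_vector_field G q.
Proof. by rewrite inE => /andP[]. Qed.

Lemma primitive_facet q : primitive_vector_field G q -> facet q.1 q.2.
Proof. by case/and3P. Qed.

Lemma opposite_tail q q' : primitive_vector_field G q ->
  primitive_vector_field G q' -> q.2 = q'.2 -> q'.1 != q.1 -> q'.1 = arc_head q.
Proof.
move=> pq pq' e2; apply: facet_edge; first by have [] := primitive_card pq.
  exact: primitive_facet.
by rewrite e2; exact: primitive_facet.
Qed.

(** If two arcs on one edge had distinct tails, the tail of each would be the head of the other, and
    the two rank inequalities would contradict each other. *)
Lemma upward_inj : {in upward &, injective (fun q => q.2)}.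
Proof.
move=> q q' qU q'U /= e2.
have pq := upward_primitive qU; have pq' := upward_primitive q'U.
have [e1|ne1] := eqVneq q'.1 q.1.
  by rewrite (surjective_pairing q) (surjective_pairing q') e1 e2.
have tq' := opposite_tail pq pq' e2 ne1.
have tq : q.1 = arc_head q' by apply: opposite_tail => //; rewrite eq_sym.
move: qU q'U; rewrite !inE => /andP[_ lt1] /andP[_ lt2].
by move: lt2; rewrite /arc_tail tq' -tq ltnNge ltnW.
Qed.

(** The endpoints of an edge have distinct ranks; the lower one is the tail of an upward arc on that
    edge. *)
Lemma card_upward : nb_edges G <= #|upward|.
Proof.
apply: leq_trans _ (leq_imset_card (fun q => q.2) _).
apply/subset_leq_card/subsetP => t /setIdP[tG /cards2P[x [y [xy tE]]]].
have xG : [set x] \in G.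
  by apply: simplex_face tG _ _; rewrite ?sub1set ?tE ?set21// -card_gt0 cards1.
have yG : [set y] \in G.
  by apply: simplex_face tG _ _; rewrite ?sub1set ?tE ?set22// -card_gt0 cards1.
have tx : t :\: [set x] = [set y].
  by rewrite tE setDUl setDv set0U; apply/setDidPl; rewrite disjoints1 inE eq_sym.
have ty : t :\: [set y] = [set x].
  by rewrite tE setDUl setDv setU0; apply/setDidPl; rewrite disjoints1 inE.
have fx z : z \in t -> facet [set z] t.
  by move=> zt; rewrite /facet sub1set zt cards1 tE cards2 xy.
have [lt|] := ltnP (arc_rank [set x]) (arc_rank [set y]).
  apply/imsetP; exists ([set x], t) => //.
  rewrite inE /primitive_vector_field /= xG tG fx ?tE ?set21//=.
  by rewrite /arc_head /= -tE tx.
rewrite leq_eqVlt => /orP[/eqP/val_inj/enum_rank_inj/set1_inj yx|lt].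
  by rewrite yx eqxx in xy.
apply/imsetP; exists ([set y], t) => //.
rewrite inE /primitive_vector_field /= yG tG fx ?tE ?set22//=.
by rewrite /arc_head /= -tE ty.
Qed.

(** An upward arc is determined by its edge, and the edges of the arcs that touch [v] are neighbours
    of [v] in the Hasse diagram. *)
Lemma card_upward_at v :
  #|[set q in upward | (arc_tail q == v) || (arc_head q == v)]| <=
    max_hasse_degree G.
Proof.
set A := [set q in _ | _].
have [->|[q0 /setIdP[/upward_primitive pq0 q0v]]] := set_0Vmem A.
  by rewrite cards0.
have vG : v \in G.
  case/orP: q0v => /eqP <-; first by case/and3P: pq0.
  by have [] := primitive_head pq0.
rewrite -(@card_in_imset _ _ (fun q => q.2)); last first.
  by move=> q q' /setIdP[qU _] /setIdP[q'U _]; exact: upward_inj.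
apply: leq_trans (leq_bigmax_cond _ vG); apply/subset_leq_card/subsetP => t.
case/imsetP => q /setIdP[/upward_primitive pq qv] ->.
have [q1 q2 sq] := and3P pq.
rewrite inE q2 /hasse vG q2 /=; apply/orP; left.
case/orP: qv => /eqP <- //.
have [c1 c2] := primitive_card pq.
by rewrite /facet /arc_head subsetDl cardsD (setIidPr _) ?c1 ?c2//; case/andP: sq.
Qed.

Lemma forestP F : reflect (discrete_vector_field G F /\ acyclic G F) (forest F).
Proof. exact: asboolP. Qed.

Lemma forest_set0 : forest set0.
Proof.
apply/forestP; split.
  split=> [q|s _]; first by rewrite inE.
  by rewrite eq_card0// => q; rewrite !inE.
by move=> s [|[t s'] p] //=; rewrite /vcycle /= inE /= !andbF.
Qed.

Lemma forest_morse F : F != set0 -> forest F = (F \in morse_simplices G).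
Proof.
move=> F0; rewrite inE; apply/forestP/asboolP => [[? ?]//|[_ ? ?]//].
Qed.

Lemma forestW F W : forest W -> F \subset W -> forest F.
Proof.
move=> fW FW; have [F0|F0] := eqVneq F set0.
  by rewrite F0 forest_set0.
have W0 : W != set0 by apply: contraNneq F0 => W0; rewrite -subset0 -W0.
by move: fW; rewrite !forest_morse// => /morse_simplex_face; exact.
Qed.

Lemma forest_tail_inj F : forest F -> {in F &, injective arc_tail}.
Proof.
move=> /forestP[[pF dF] _] q q' qF q'F tq.
have /dF/card_le1_eqP : q.1 \in G by case/and3P: (pF q qF).
by apply; rewrite inE ?qF ?q'F /= ?eqxx// -[q'.1]/(arc_tail q') -tq eqxx.
Qed.

(** * Adding free arcs to a forest *)

Section FreeUnion.
Variables (F W : {set arc}).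
Hypotheses (F_forest : forest F) (W_free : W \subset free_arcs F).

Lemma free_tail q : q \in W -> arc_tail q \notin arc_tail @: F.
Proof. by move=> /(subsetP W_free); rewrite inE => /and3P[]. Qed.

Lemma free_head q : q \in W -> arc_head q \notin arc_tail @: F.
Proof. by move=> /(subsetP W_free); rewrite inE => /and3P[]. Qed.

Lemma free_upward q : q \in W -> q \in upward.
Proof. by move=> /(subsetP W_free); rewrite inE => /andP[]. Qed.

Lemma vpath_head (V : {set arc}) v t s p :
  {subset V <= primitive_vector_field G} ->
  vpath G V v ((t, s) :: p) -> s = arc_head (v, t).
Proof.
move=> pV /= /andP[_ /and4P[vt st sv _]].
have pq : primitive_vector_field G (v, t) := pV _ vt.
by apply: facet_edge => //; [case: (primitive_card pq)|exact: (primitive_facet pq)].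
Qed.

Lemma forest_primitive q : q \in F -> primitive_vector_field G q.
Proof. by case/forestP: F_forest => -[pF _] _; exact: pF. Qed.

Lemma union_primitive : {subset F :|: W <= primitive_vector_field G}.
Proof.
move=> q; rewrite inE => /orP[qF|qW]; first exact: forest_primitive.
exact/upward_primitive/free_upward.
Qed.

(* Outside the tails of [F] a path only uses arcs of [W], so it climbs and never
   comes back to a arc_tail of [F]. *)
Lemma free_path v p : vpath G (F :|: W) v p -> v \notin arc_tail @: F ->
  last v (unzip2 p) \notin arc_tail @: F /\
  (0 < size p -> arc_rank v < arc_rank (last v (unzip2 p))).
Proof.
elim: p v => [//|[t s] p IHp] v vp vF.
have sE := vpath_head union_primitive vp.
move: vp => /= /andP[_ /and4P[vt _ _ sp]].
have vtW : (v, t) \in W.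
  move: vt; rewrite inE => /orP[vtF|//].
  by case/negP: vF; apply/imsetP; exists (v, t).
have [|lF lp] := IHp s sp; first by rewrite sE free_head.
split=> // _; have vs : arc_rank v < arc_rank s.
  by have := free_upward vtW; rewrite inE sE => /andP[].
by case: p lp {IHp lF sp} => [//|a p] lp; apply: ltn_trans vs _; exact: lp.
Qed.

(** An arc of [W] on the path would lead to a vertex that is no tail of [F], and by [free_path] the
    path could not end at a tail of [F] afterwards. *)
Lemma forest_path v p : vpath G (F :|: W) v p ->
  last v (unzip2 p) \in arc_tail @: F -> vpath G F v p.
Proof.
elim: p v => [//|[t s] p IHp] v vp lF.
have sE := vpath_head union_primitive vp.
move: vp => /= /andP[vG /and4P[vt st sv sp]].
rewrite vG st sv (IHp s sp lF) /= andbT.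
move: vt; rewrite inE => /orP[//|vtW].
by have [|/negP] := free_path sp; first by rewrite sE free_head.
Qed.

(** A cycle based at a tail of [F] would be a cycle of [F]; a cycle based elsewhere would strictly
    increase the rank of its base point. *)
Lemma forest_union : {in W &, injective arc_tail} -> forest (F :|: W).
Proof.
move=> injW; have [[pF dF] aF] := forestP _ F_forest; apply/forestP; split.
  split=> [|v vG]; first exact: union_primitive.
  apply/card_le1_eqP.
  have same q q' : q \in F :|: W -> q' \in F :|: W ->
      q.1 = q'.1 \/ q.2 = q'.2 -> q = q'.
    (* An arc of [F] and a free arc on the same edge with distinct tails would make the tail of the
       former the head of the latter. *)
    have FW a b : a \in F -> b \in W -> a.1 = b.1 \/ a.2 = b.2 -> False.
      move=> aFF bW ab; have tF : a.1 \in arc_tail @: F by apply/imsetP; exists a.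
      have [e1|ne1] := eqVneq a.1 b.1.
        by have := free_tail bW; rewrite -[arc_tail b]e1 tF.
      case: ab => [e1|e2]; first by rewrite e1 eqxx in ne1.
      have := free_head bW; rewrite -(opposite_tail _ _ (esym e2) ne1) ?tF//.
        by apply: union_primitive; rewrite inE bW orbT.
      exact: forest_primitive.
    rewrite !inE => /orP[qF|qW] /orP[q'F|q'W] qq'.
    - case: qq' => [e1|e2]; first exact: (forest_tail_inj F_forest).
      have /dF/card_le1_eqP : q.2 \in G by case/and3P: (pF q qF).
      by apply; rewrite inE ?qF ?q'F ?e2 eqxx orbT.
    - by case: (FW q q').
    - by case: (FW q' q) => //; case: qq' => ->; [left|right].
    - case: qq' => [e1|e2]; first exact: injW.
      by apply: upward_inj e2; exact: free_upward.
  move=> q q' /setIdP[qV vq] /setIdP[q'V vq'].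
  apply: same => //.
  have [c1 c2] := primitive_card (union_primitive qV).
  have [c1' c2'] := primitive_card (union_primitive q'V).
  (* The common simplex is a vertex for both arcs or an edge for both; the mixed cases fail by
     cardinality. *)
  case/orP: vq => /eqP vq; case/orP: vq' => /eqP vq'.
  - by left; rewrite -vq -vq'.
  - by move: c2'; rewrite -vq' vq c1.
  - by move: c2; rewrite -vq vq' c1'.
  - by right; rewrite -vq -vq'.
move=> v p; apply/negP => /and3P[p0 vp /eqP lv].
have [vF|vF] := boolP (v \in arc_tail @: F).
  case/negP: (aF v p); apply/and3P; split=> //; last by rewrite lv.
  by apply: forest_path vp _; rewrite lv.
by have [_ /(_ p0)] := free_path vp vF; rewrite lv ltnn.
Qed.

End FreeUnion.

(** The arcs lost are upward arcs that touch the tail of [q]. *)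
Lemma card_free F q :
  #|free_arcs F| <= #|free_arcs (q |: F)| + max_hasse_degree G.
Proof.
set A := [set q' in upward |
  (arc_tail q' == arc_tail q) || (arc_head q' == arc_tail q)].
apply: leq_trans (leq_add (leqnn _) (card_upward_at (arc_tail q))).
rewrite -/A; apply: leq_trans (leq_card_setU _ A); apply/subset_leq_card/subsetP.
move=> q'; rewrite !inE imsetU1 !inE => /and3P[-> tF hF] /=.
by rewrite (negbTE tF) (negbTE hF) !orbF -negb_or orNb.
Qed.

(** The free arcs are sorted by tail, and each tail carries at most [max_hasse_degree G] of them.
    This bounds from below the number of factors of the join. *)
Lemma card_free_tails F :
  #|free_arcs F| <= #|arc_tail @: free_arcs F| * max_hasse_degree G.
Proof.
rewrite -sum1_card (partition_big_imset arc_tail) /= -sum_nat_const.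
apply: leq_sum => v _; rewrite sum1_card.
apply: leq_trans (card_upward_at v); apply/subset_leq_card/subsetP => q.
by move=> /andP[/setIdP[qU _] tq]; rewrite inE qU tq.
Qed.

Lemma free_set0 : free_arcs set0 = upward.
Proof. by apply/setP => q; rewrite inE imset0 !inE andbT. Qed.

End Forests.

From mathcomp Require Import all_order all_algebra.
From mathcomp Require Import all_classical all_reals all_analysis.
From mathcomp Require Import ring lra zify.
Import Order.TTheory GRing.Theory Num.Theory.
Import numFieldNormedType.Exports.

Local Open Scope classical_set_scope.
Local Open Scope ring_scope.

(** * Extension of maps from the boundary of a box *)

Lemma within_continuous_comp_sub (X Y Z : topologicalType) (A : set X)
    (B : set Y) (f : X -> Y) (g : Y -> Z) :
  {within A, continuous f} -> (forall x, A x -> B (f x)) ->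
  {within B, continuous g} -> {within A, continuous (g \o f)}.
Proof.
move=> /subspace_continuousP cf AB /subspace_continuousP cg.
apply/subspace_continuousP => x Ax; have Bfx := AB x Ax.
apply: (@cvg_comp _ _ _ f g _ (within B (nbhs (f x)))); last exact: cg.
move=> U BU; have := cf x Ax _ BU.
rewrite !nbhs_simpl /=.
apply: filterS2 (withinT A (nbhs_filter x)).
by move=> y Ay; apply; exact: AB.
Qed.

Lemma within_continuous_eq (X Y : topologicalType) (A : set X) (f g : X -> Y) :
  (forall x, A x -> f x = g x) -> {within A, continuous f} ->
  {within A, continuous g}.
Proof.
by move=> fg; apply: subspace_eq_continuous => x; rewrite inE; exact: fg.
Qed.

Section WithinOps.
Variables (R : realType) (X : topologicalType) (V : normedModType R) (A : set X).

Lemma within_continuous_cst (z : V) : {within A, continuous (fun=> z)}.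
Proof. by move=> x; exact: cvg_cst. Qed.

Lemma within_continuousD (f g : X -> V) :
  {within A, continuous f} -> {within A, continuous g} ->
  {within A, continuous (fun x => f x + g x)}.
Proof. by move=> cf cg x; exact: cvgD (cf x) (cg x). Qed.

Lemma within_continuousN (f : X -> V) :
  {within A, continuous f} -> {within A, continuous (fun x => - f x)}.
Proof. by move=> cf x; exact: cvgN (cf x). Qed.

Lemma within_continuousZ (s : X -> R) (f : X -> V) :
  {within A, continuous s} -> {within A, continuous f} ->
  {within A, continuous (fun x => s x *: f x)}.
Proof. by move=> cs cf x; exact: cvgZ (cs x) (cf x). Qed.

Lemma within_continuousM (f g : X -> R) :
  {within A, continuous f} -> {within A, continuous g} ->
  {within A, continuous (fun x => f x * g x)}.
Proof. by move=> cf cg x; exact: cvgM (cf x) (cg x). Qed.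

Lemma within_continuousV (f : X -> R) : (forall x, A x -> f x != 0) ->
  {within A, continuous f} -> {within A, continuous (fun x => (f x)^-1)}.
Proof.
move=> f0 /subspace_continuousP cf; apply/subspace_continuousP => x Ax.
exact: cvgV (f0 x Ax) (cf x Ax).
Qed.
Lemma within_continuous_norm (f : X -> V) :
  {within A, continuous f} -> {within A, continuous (fun x => `|f x|)}.
Proof. by move=> cf x; exact: cvg_norm (cf x). Qed.
End WithinOps.

Lemma within_ptws_continuousP (R : realType) (V : finType) (X : topologicalType)
    (A : set X) (f : X -> {ptws V -> R}) :
  {within A, continuous f} <-> forall v, {within A, continuous (f ^~ v)}.
Proof.
split=> [cf v x|cf].
  apply: (@cvg_comp _ _ _ f (fun h : {ptws V -> R} => h v) _ (nbhs (f x))).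
    exact: cf.
  exact: (@proj_continuous V (fun=> R) v).
suff: continuous (f : subspace A -> prod_topology (fun _ : V => R)) by [].
move=> x; apply/cvg_sup => v; move: x.
apply/(@continuousP _ (initial_topology (@^~ v))) => _ [B oB <-].
exact: (iffLR (continuousP _) (cf v) B oB).
Qed.

Lemma within_row_continuous (R : realType) n (X : topologicalType) (A : set X)
    (f : X -> 'rV[R]_n) :
  (forall i, {within A, continuous (fun x => f x ord0 i)}) ->
  {within A, continuous f}.
Proof.
move=> cf x U [P /= fP PU]; rewrite nbhs_simpl /=.
suff: \forall y \near (x : subspace A), forall i, P ord0 i (f y ord0 i).
  by apply: filterS => y Py; apply: PU => i j; rewrite (ord1 i).
by apply: filter_forall => i; exact: cf (fP ord0 i).
Qed.

Lemma ler_rV_norm (R : realType) n (u : 'rV[R]_n) (e : R) :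
  0 <= e -> (`|u| <= e) <-> (forall i, `|u ord0 i| <= e).
Proof.
move=> e0; rewrite {1}/Num.norm /= mx_normrE; split.
  by move=> /bigmax_leP[_ H] i; exact: (H (ord0, i)).
by move=> H; apply/bigmax_leP; split=> // -[i j] _; rewrite (ord1 i); exact: H.
Qed.

(** * Boxes and their boundaries *)

Section Boxes.
Variables (R : realType) (n : nat).
Implicit Types (x y : 'rV[R]_n) (D : {set 'I_n}) (r : R).

(** Only the coordinates in [D] vary, so that the faces of a box are boxes of the same ambient
    space. *)
Definition box x D r : set 'rV[R]_n :=
  [set y | forall i, x ord0 i <= y ord0 i <= x ord0 i + (i \in D)%:R * r].

(** The boundary relative to the affine span of the box; it is empty when [D] is empty. *)
Definition box_bd x D r : set 'rV[R]_n :=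
  [set y | box x D r y /\ exists2 i, i \in D &
     y ord0 i = x ord0 i \/ y ord0 i = x ord0 i + r].

Lemma closed_box x D r : closed (box x D r).
Proof.
rewrite (_ : box x D r = \bigcap_i
    ((fun y => y ord0 i) @^-1` `[x ord0 i, x ord0 i + (i \in D)%:R * r])).
  apply: closed_bigI => i _; apply: closed_comp.
    by move=> y _; exact: coord_continuous.
  exact: itv_closed.
by rewrite predeqE => y; split=> [H i _|H i] /=;
  [rewrite in_itv; exact: H|have := H i I; rewrite /= in_itv].
Qed.

Lemma closed_box_bd x D r : closed (box_bd x D r).
Proof.
rewrite (_ : box_bd x D r = box x D r `&` \bigcup_(i in [set i | i \in D])
    ((fun y => y ord0 i) @^-1` ([set x ord0 i] `|` [set x ord0 i + r]))).
  apply: closedI; first exact: closed_box.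
  apply: closed_bigcup; first exact: finite_finset.
  move=> i _; apply: closed_comp => [y _|]; first exact: coord_continuous.
  by apply: closedU; exact: closed_eq.
rewrite predeqE => y; split=> [[yB [i iD yi]]|[yB [i iD yi]]]; split=> //;
  by exists i.
Qed.

Lemma compact_box_bd x D r : compact (box_bd x D r).
Proof.
apply: (@subclosed_compact _ _ (box x D r)); [exact: closed_box_bd| |by move=> y []].
rewrite (_ : box x D r = [set y | forall i,
    `[x ord0 i, x ord0 i + (i \in D)%:R * r]%classic (y ord0 i)]).
  apply: (@rV_compact R n (fun i =>
    `[x ord0 i, x ord0 i + (i \in D)%:R * r]%classic)) => i.
  exact: segment_compact.
by rewrite predeqE => y; split=> H i; have := H i; rewrite /= in_itv.
Qed.

End Boxes.

Section Extension.
Variables (R : realType) (M : topologicalType).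

(* For [m >= 1] this expresses that [A] is [(m - 2)]-connected. *)
Definition extensive (m : nat) (A : set M) : Prop :=
  forall n (x : 'rV[R]_n) (D : {set 'I_n}) (r : R) (f : 'rV[R]_n -> M),
    0 < r -> (#|D| < m)%N -> {within box_bd x D r, continuous f} ->
    (forall y, box_bd x D r y -> A (f y)) ->
    exists g, [/\ {within box x D r, continuous g},
      forall y, box x D r y -> A (g y) & forall y, box_bd x D r y -> g y = f y].

Lemma extensiveW m k A : (k <= m)%N -> extensive m A -> extensive k A.
Proof. by move=> km eA n x D r f r0 Dk; apply: eA => //; exact: leq_trans km. Qed.

End Extension.

(** * Subdivision of a box into cells *)

Section Grid.
Variables (R : realType) (n : nat) (x : 'rV[R]_n) (D : {set 'I_n}) (r : R).
Variable N : nat.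
Hypotheses (r_gt0 : 0 < r) (N_gt0 : (0 < N)%N).

(* The cell [(p, E)] stands for the product of the intervals [p i, p i + 1] for
   [i] in [E] and of the points [p i] for the other [i], in units of [r / N]. *)
Definition cell : finType := ({ffun 'I_n -> 'I_N.+1} * {set 'I_n})%type.
Implicit Type c : cell.

Definition mesh : R := r / N%:R.

Definition corner (p : {ffun 'I_n -> 'I_N.+1}) : 'rV[R]_n :=
  \row_i (x ord0 i + (p i)%:R * mesh).

Definition cbox c : set 'rV[R]_n := box (corner c.1) c.2 mesh.
Definition cbox_bd c : set 'rV[R]_n := box_bd (corner c.1) c.2 mesh.

(** The type [cell] also contains pairs that stick out of the box; these conditions select the cells
    of the subdivision, of every dimension. *)
Definition grid_cell c : Prop :=
  [/\ forall i, i \in c.2 -> i \in D,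
      forall i, i \notin D -> c.1 i = 0%N :> nat &
      forall i, i \in c.2 -> (c.1 i < N)%N].

Lemma mesh_gt0 : 0 < mesh.
Proof. by rewrite divr_gt0// ltr0n. Qed.

Lemma mul_mesh : N%:R * mesh = r.
Proof. by rewrite mulrC divfK// pnatr_eq0 -lt0n. Qed.

Lemma cboxP c y : cbox c y <-> forall i,
  (c.1 i)%:R * mesh <= y ord0 i - x ord0 i <= (c.1 i + (i \in c.2))%N%:R * mesh.
Proof.
by split=> H i; have := H i; rewrite mxE natrD mulrDl; move=> /andP[? ?];
  apply/andP; split; lra.
Qed.

Lemma cbox_bdP c y : cbox_bd c y <-> cbox c y /\ exists2 i, i \in c.2 &
  y ord0 i - x ord0 i = (c.1 i)%:R * mesh \/
  y ord0 i - x ord0 i = (c.1 i).+1%:R * mesh.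
Proof.
split=> -[cy [i ci yi]]; split=> //; exists i => //; move: yi;
  rewrite mxE -[(c.1 i).+1]addn1 natrD mulrDl => -[|] ?; [left|right|left|right]; lra.
Qed.

Lemma boxP y : box x D r y <-> forall i,
  0 <= y ord0 i - x ord0 i <= (N * (i \in D))%N%:R * mesh.
Proof.
split=> H i; have := H i; rewrite natrM mulrAC mul_mesh;
  by move=> /andP[? ?]; apply/andP; split; lra.
Qed.

Lemma box_bdP y : box_bd x D r y <-> box x D r y /\ exists2 i, i \in D &
  y ord0 i - x ord0 i = 0 \/ y ord0 i - x ord0 i = N%:R * mesh.
Proof.
rewrite mul_mesh; split=> -[cy [i ci yi]]; split=> //; exists i => //;
  by move: yi => -[|] ?; [left|right]; lra.
Qed.

Lemma ler_mesh (a b : nat) : (a%:R * mesh <= b%:R * mesh) = (a <= b)%N.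
Proof. by rewrite ler_pM2r ?mesh_gt0// ler_nat. Qed.

Lemma ltr_mesh (a b : nat) : (a%:R * mesh < b%:R * mesh) = (a < b)%N.
Proof. by rewrite ltr_pM2r ?mesh_gt0// ltr_nat. Qed.

Lemma mesh_inj (a b : nat) : a%:R * mesh = b%:R * mesh -> a = b.
Proof.
by move=> ab; apply/eqP; rewrite eqn_leq -!ler_mesh ab lexx.
Qed.

Lemma cbox_sub_box c : grid_cell c -> cbox c `<=` box x D r.
Proof.
move=> [cD cD0 cN] y /cboxP cy; apply/boxP => i; have /andP[cy1 cy2] := cy i.
apply/andP; split.
  by apply: le_trans cy1; rewrite mulr_ge0// ltW// mesh_gt0.
apply: le_trans cy2 _; rewrite ler_mesh.
have := ltn_ord (c.1 i).
case: (boolP (i \in D)) => iD; last first.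
  by rewrite cD0// (contraNF (@cD i) iD).
case: (boolP (i \in c.2)) => ic; last by lia.
by have := cN i ic; lia.
Qed.

Lemma cbox_sub_bd c i : grid_cell c -> i \in D -> i \notin c.2 ->
  (c.1 i == 0 :> nat) || (c.1 i == N :> nat) -> cbox c `<=` box_bd x D r.
Proof.
move=> vc iD ic ci y cy; apply/box_bdP; split; first exact: cbox_sub_box cy.
exists i => //; move/cboxP: cy => /(_ i).
rewrite (negbTE ic) addn0 -eq_le => /eqP <-.
by case/orP: ci => /eqP ->; [left; rewrite mul0r|right].
Qed.

(** A cell frozen at an end of the box in some direction of [D] lies in the boundary. Any other cell
    meets the boundary only in a direction in which it extends, hence at an end of its own
    interval. *)
Lemma cbox_bd_dichotomy c : grid_cell c ->
  cbox c `<=` box_bd x D r \/ cbox c `&` box_bd x D r `<=` cbox_bd c.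
Proof.
move=> vc.
have [/existsP[i /and3P[iD ic ci]]|] := boolP [exists i, [&& i \in D,
    i \notin c.2 & (c.1 i == 0 :> nat) || (c.1 i == N :> nat)]].
  by left; exact: cbox_sub_bd ci.
rewrite negb_exists => /forallP nc; right => y [cy /box_bdP[_ [i iD yi]]].
move/cboxP: (cy) => /(_ i) cyi.
have ic : i \in c.2.
  apply: contraT => ic; have := nc i; rewrite iD ic /= negb_or.
  move: cyi; rewrite (negbTE ic) addn0 -eq_le => /eqP cyi.
  have {cyi} : c.1 i = 0%N :> nat \/ c.1 i = N :> nat.
    by case: yi => yi; [left|right]; apply: mesh_inj; rewrite cyi yi ?mul0r.
  by case=> ->; rewrite eqxx ?andbF.
apply/cbox_bdP; split=> //; exists i => //.
move: cyi; rewrite ic addn1 => /andP[ge_yi le_yi]; case: yi => yi.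
  left; apply/eqP; rewrite eq_le ge_yi andbT yi mulr_ge0// ltW// mesh_gt0//.
have [_ _ /(_ i ic) ciN] := vc.
by right; apply/eqP; rewrite eq_le le_yi yi ler_mesh.
Qed.

(** The facet [c'] is obtained by freezing a coordinate in which [y] is at an end of the cell. *)
Lemma cbox_bd_facet c y : grid_cell c -> cbox_bd c y -> exists c',
  [/\ grid_cell c', (#|c'.2| < #|c.2|)%N, cbox c' `<=` cbox c & cbox c' y].
Proof.
move=> [cD cD0 cN] /cbox_bdP[cy [i ic yi]].
have [q [yq lq]] : exists q : 'I_N.+1,
    y ord0 i - x ord0 i = q%:R * mesh /\ (c.1 i <= q <= (c.1 i).+1)%N.
  case: yi => yi; first by exists (c.1 i); rewrite leqnn leqnSn.
  have ciN : ((c.1 i).+1 < N.+1)%N by rewrite ltnS cN.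
  by exists (Ordinal ciN); rewrite leqnn leqnSn.
exists ([ffun j => if j == i then q else c.1 j], c.2 :\ i)%SET.
split=> /=.
- split=> /= j.
  + by rewrite in_setD1 => /andP[_]; exact: cD.
  + by move=> jD; rewrite ffunE; case: eqP jD => [-> | _]; [rewrite cD | exact: cD0].
  + by rewrite in_setD1 ffunE => /andP[/negbTE ->]; exact: cN.
- by rewrite [leqRHS](cardsD1 i) ic.
- move=> z /cboxP zc'; apply/cboxP => j; have := zc' j.
  rewrite /= ffunE in_setD1; case: eqP => [->|_] //=.
  rewrite addn0 ic addn1 => /andP[z1 z2]; apply/andP; split.
    by apply: le_trans z1; rewrite ler_mesh; case/andP: lq.
  by apply: le_trans z2 _; rewrite ler_mesh; case/andP: lq.
- apply/cboxP => j; rewrite /= ffunE in_setD1.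
  case: eqP => [->|_] /=; first by rewrite addn0 yq lexx.
  by move/cboxP: cy => /(_ j).
Qed.

(** A point in the relative interior of [c] has non-integral coordinates, in units of the mesh,
    along [c.2]; every cell containing it extends in these directions, and one of no larger
    dimension must be [c]. *)
Lemma cbox_overlap c c' : c' <> c -> (#|c'.2| <= #|c.2|)%N ->
  cbox c `&` cbox c' `<=` cbox_bd c.
Proof.
move=> c'c cardc y [/[dup] cy /cboxP cyP /cboxP c'yP].
apply: contrapT => /cbox_bdP /not_andP[//|ncy]; apply: c'c.
have yint i : i \in c.2 ->
    (c.1 i)%:R * mesh < y ord0 i - x ord0 i < (c.1 i).+1%:R * mesh.
  move=> ic; have := cyP i; rewrite ic addn1 !lt_neqAle => /andP[-> ->].
  rewrite !andbT; apply/andP; split; apply/eqP => yi; apply: ncy; exists i => //.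
    by left.
  by right.
have e2 : c.2 = c'.2.
  apply/eqP; rewrite eqEcard cardc andbT; apply/fintype.subsetP => i ic.
  apply: contraT => ic'; have := c'yP i; rewrite (negbTE ic') addn0 -eq_le.
  by move=> /eqP yi; have := yint i ic; rewrite -yi !ltr_mesh; lia.
rewrite (surjective_pairing c) (surjective_pairing c') -e2; congr pair.
apply/ffunP => i; apply/val_inj; have := c'yP i; have := cyP i.
rewrite -e2; case: (boolP (i \in c.2)) => ic.
  move=> _; have /andP[y1 y2] := yint i ic; rewrite addn1 => /andP[y3 y4].
  have := le_lt_trans y3 y2; have := lt_le_trans y1 y4.
  by rewrite !ltr_mesh /=; lia.
by rewrite !addn0 -!eq_le => /eqP y1 /eqP y2; apply: mesh_inj; rewrite y1 y2.
Qed.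

Lemma cbox_cover y : box x D r y ->
  exists c, [/\ grid_cell c, c.2 = D & cbox c y].
Proof.
move=> /boxP yP.
pose k i := Num.truncn ((y ord0 i - x ord0 i) / mesh).
(* The minimum puts the points of the upper face of the box into the last cell. *)
pose p := [ffun i => if i \in D then inord (minn (k i) N.-1) else 0] :
  {ffun 'I_n -> 'I_N.+1}.
have pE i : i \in D -> p i = minn (k i) N.-1 :> nat.
  by move=> iD; rewrite ffunE iD inordK// ltnS; lia.
exists (p, D); split=> //.
  split=> [//|i iD|i iD] /=; first by rewrite ffunE (negbTE iD).
  by rewrite pE//; lia.
apply/cboxP => i /=; have := yP i; case: (boolP (i \in D)) => iD; last first.
  have -> : p i = 0%N :> nat by rewrite ffunE (negbTE iD).
  by rewrite muln0 mul0r.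
rewrite muln1 => /andP[y0 yN]; rewrite pE// addn1.
have [] : (k i)%:R * mesh <= y ord0 i - x ord0 i /\
    y ord0 i - x ord0 i < (k i).+1%:R * mesh.
  rewrite -ler_pdivlMr ?mesh_gt0// -ltr_pdivrMr ?mesh_gt0//.
  by apply/andP/truncn_itv; rewrite divr_ge0// ltW// mesh_gt0.
move=> k1 k2; have kN := le_trans k1 yN; rewrite ler_mesh in kN.
case: (leqP (k i) N.-1) => kN1.
  by rewrite k1 ltW.
by rewrite prednK// yN andbT; apply: le_trans k1; rewrite ler_mesh ltnW.
Qed.

Lemma cbox_sub_top c : grid_cell c ->
  exists Q, [/\ grid_cell Q, Q.2 = D & cbox c `<=` cbox Q].
Proof.
move=> [cD cD0 cN].
(* A coordinate frozen at [N] is the upper end of the last interval, which starts at [N.-1]. *)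
pose p := [ffun i => if (i \in D) && (c.1 i == N :> nat) then inord N.-1
  else c.1 i] : {ffun 'I_n -> 'I_N.+1}.
exists (p, D); split=> //.
  split=> [//|i iD|i iD] /=; first by rewrite ffunE (negbTE iD) cD0.
  rewrite ffunE iD /=; case: eqP => [_|]; first by rewrite inordK; lia.
  by move=> /eqP ciN; rewrite ltn_neqAle ciN -ltnS ltn_ord.
move=> y /cboxP cy; apply/cboxP => i; have := cy i; rewrite /= ffunE.
case: (boolP (i \in D)) => iD /=; last first.
  by rewrite (contraNF (@cD i) iD).
case: eqP => ciN /andP[y1 y2].
  rewrite inordK; last by lia.
  have ic : (i \in c.2) = false.
    by apply/negP => /cN; rewrite ciN ltnn.
  rewrite ciN ic addn0 in y1 y2; rewrite addn1 prednK// y2 andbT.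
  by apply: le_trans y1; rewrite ler_mesh; lia.
rewrite y1; apply: le_trans y2 _; rewrite ler_mesh leq_add2l.
exact: leq_b1.
Qed.

(** The lowest and the highest corner of [c] lie in [cbox c'], which bounds each coordinate of [c.1]
    by that of [c'.1] from both sides. *)
Lemma cbox_top_inj c c' : grid_cell c -> grid_cell c' -> c.2 = D -> c'.2 = D ->
  cbox c `<=` cbox c' -> c = c'.
Proof.
move=> [_ c0 _] [_ c'0 _] cD c'D cc'.
rewrite (surjective_pairing c) (surjective_pairing c') cD c'D; congr pair.
apply/ffunP => i; apply/val_inj => /=.
case: (boolP (i \in D)) => iD; last by rewrite c0// c'0.
have /cboxP/(_ i) : cbox c' (corner c.1).
  apply: cc'; apply/cboxP => j; rewrite mxE addrAC subrr add0r lexx ler_mesh.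
  exact: leq_addr.
have /cboxP/(_ i) :
    cbox c' (\row_i (x ord0 i + (c.1 i + (i \in c.2))%N%:R * mesh)).
  apply: cc'; apply/cboxP => j; rewrite mxE addrAC subrr add0r lexx ler_mesh.
  by rewrite leq_addr.
rewrite !mxE !(addrC (x ord0 i)) !addrK !ler_mesh cD c'D iD !addn1.
move=> /andP[_ a] /andP[b _]; rewrite ltnS in a.
by apply/eqP; rewrite eqn_leq a b.
Qed.

End Grid.

(** [Phi] prescribes a target for each cell, smaller for smaller cells. The cells are filled in
    order of dimension: the boundary of a new cell is already mapped into the targets of its facets,
    hence into its own target, which is extensive in its dimension. *)
Lemma grid_extension (R : realType) (M : topologicalType) n (x : 'rV[R]_n)
    (D : {set 'I_n}) (r : R) (N : nat) (Phi : cell n N -> set M)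
    (f : 'rV[R]_n -> M) :
  0 < r -> (0 < N)%N -> {within box_bd x D r, continuous f} ->
  (forall c y, grid_cell D c -> cbox x r c y -> box_bd x D r y -> Phi c (f y)) ->
  (forall c c', grid_cell D c -> grid_cell D c' ->
     cbox x r c' `<=` cbox x r c -> Phi c' `<=` Phi c) ->
  (forall c, grid_cell D c -> extensive R #|c.2|.+1 (Phi c)) ->
  exists g, [/\ {within box x D r, continuous g},
    forall c y, grid_cell D c -> cbox x r c y -> Phi c (g y) &
    forall y, box_bd x D r y -> g y = f y].
Proof.
move=> r0 N0 cf fPhi Phi_sub ePhi.
pose dom (S : {set cell n N}) :=
  box_bd x D r `|` \bigcup_(c in [set c | c \in S]) cbox x r c.
have closed_dom S : closed (dom S).
  apply: closedU; first exact: closed_box_bd.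
  by apply: closed_bigcup => [|c _]; [exact: finite_finset|exact: closed_box].
(* The set [S] contains all grid cells of smaller dimension than one of its members, in particular
   the facets of its members. *)
suff main k (S : {set cell n N}) : (#|S| <= k)%N ->
    (forall c, c \in S -> grid_cell D c) ->
    (forall c c', c \in S -> grid_cell D c' -> (#|c'.2| < #|c.2|)%N -> c' \in S) ->
    exists g, [/\ {within dom S, continuous g},
      forall c y, c \in S -> cbox x r c y -> Phi c (g y) &
      forall y, box_bd x D r y -> g y = f y].
  pose S := finset (fun c : cell n N => `[< grid_cell D c >]).
  have SP c : c \in S -> grid_cell D c by rewrite inE => /asboolP.
  have [|g [gc gPhi gf]] := main _ _ (leqnn #|S|) SP.
    by move=> c c' _ gc' _; rewrite inE; apply/asboolP.
  exists g; split=> //.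
    apply: continuous_subspaceW gc => y /(cbox_cover r0 N0)[c [c_grid _ cy]].
    by right; exists c => //=; rewrite inE; apply/asboolP.
  by move=> c y c_grid cy; apply: gPhi cy; rewrite inE; apply/asboolP.
elim: k S => [|k IHk] S Sk Sgrid Sdim.
  have S0 c : c \in S = false.
    by move: Sk; rewrite leqn0 cards_eq0 => /eqP ->; rewrite inE.
  exists f; split=> [|c y|//]; last by rewrite S0.
  by apply: continuous_subspaceW cf => y [//|[c /=]]; rewrite S0.
have [S0|[c0 c0S]] := set_0Vmem S.
  by apply: IHk => //; rewrite S0 cards0.
(* Removing a cell of maximal dimension preserves this closure property. *)
have [c cS cmax] : exists2 c, c \in S &
    forall c', c' \in S -> (#|c'.2| <= #|c.2|)%N.
  have [c cS cmax] := arg_maxnP (fun c : cell n N => #|c.2|) c0S.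
  by exists c.
have gc := Sgrid c cS.
have [g' [cg' g'Phi g'f]] : exists g, [/\ {within dom (S :\ c)%SET, continuous g},
    forall c' y, c' \in (S :\ c)%SET -> cbox x r c' y -> Phi c' (g y) &
    forall y, box_bd x D r y -> g y = f y].
  apply: IHk.
  - by move: Sk; rewrite (cardsD1 c) cS.
  - by move=> c'; rewrite in_setD1 => /andP[_]; exact: Sgrid.
  - move=> c1 c2; rewrite !in_setD1 => /andP[_ c1S] gc2 c21.
    rewrite (Sdim c1)// andbT; apply: contraTneq c21 => ->.
    by rewrite -leqNgt; exact: cmax.
have domS : dom S = dom (S :\ c)%SET `|` cbox x r c.
  rewrite predeqE => y; split.
    move=> [?|[c' /= c'S c'y]]; first by left; left.
    have [c'c|c'c] := eqVneq c' c; first by right; rewrite -c'c.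
    by left; right; exists c' => //=; rewrite in_setD1 c'c.
  move=> [[?|[c' /=]]|?]; [by left| |by right; exists c].
  by rewrite in_setD1 => /andP[_ c'S] ?; right; exists c'.
(* On a cell inside the boundary of the box the map is already [f]. Otherwise the new cell meets the
   old domain only in its own boundary. *)
have [cbd|cbd] := cbox_bd_dichotomy x r0 N0 gc.
  exists g'; split=> //.
    by apply: continuous_subspaceW cg' => y; rewrite domS => -[//|/cbd]; left.
  move=> c' y c'S c'y; have [c'c|c'c] := eqVneq c' c.
    rewrite c'c in c'y *; have bdy := cbd _ c'y; rewrite g'f//.
    exact: fPhi.
  by apply: g'Phi c'y; rewrite in_setD1 c'c.
have cbd_dom : cbox_bd x r c `<=` dom (S :\ c)%SET.
  move=> y /(cbox_bd_facet r0 N0 gc)[c' [gc' c'c _ c'y]]; right; exists c' => //=.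
  rewrite in_setD1 (Sdim c)// andbT.
  by apply: contraTneq c'c => ->; rewrite ltnn.
have [|y|h [ch hPhi hg']] :=
    ePhi c gc n (corner x r c.1) c.2 (mesh r N) g' (mesh_gt0 r0 N0) (ltnSn _).
- exact: continuous_subspaceW cg'.
- move=> /(cbox_bd_facet r0 N0 gc)[c' [gc' c'c c'sub c'y]].
  apply: (Phi_sub _ _ gc gc' c'sub); apply: g'Phi c'y.
  rewrite in_setD1 (Sdim c)// andbT.
  by apply: contraTneq c'c => ->; rewrite ltnn.
pose g y := if `[< cbox x r c y >] then h y else g' y.
have gh y : cbox x r c y -> g y = h y by rewrite /g => cy; case: asboolP.
have gg' y : dom (S :\ c)%SET y -> g y = g' y.
  rewrite /g => Sy; case: asboolP => // cy; apply: hg'.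
  case: Sy => [bdy|[c' /=]]; first exact: cbd.
  rewrite in_setD1 => /andP[/eqP c'c c'S] c'y.
  by apply: (cbox_overlap r0 N0 c'c) => //; exact: cmax.
exists g; split.
- rewrite domS; apply: withinU_continuous => //; first exact: closed_box.
    by apply: within_continuous_eq cg' => y Sy; rewrite gg'.
  by apply: within_continuous_eq ch => y Sy; rewrite gh.
- move=> c' y c'S c'y; have [c'c|c'c] := eqVneq c' c.
    by rewrite c'c in c'y *; rewrite gh//; exact: hPhi.
  rewrite gg'; last by right; exists c' => //=; rewrite in_setD1 c'c.
  by apply: g'Phi c'y; rewrite in_setD1 c'c.
- by move=> y bdy; rewrite gg' ?g'f//; left.
Qed.

(** * Extension into a union of two open sets *)

(** An oscillation below [1] prevents a small cell from meeting both the level [0] and the level [1]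
    of a function with values between them. *)
Lemma compact_uniformly_continuous (R : realType) n (K : set 'rV[R]_n)
    (h : 'rV[R]_n -> R) :
  compact K -> {within K, continuous h} -> exists2 d : R, 0 < d &
  forall y z, K y -> K z -> `|y - z| < d -> `|h y - h z| < 1.
Proof.
move=> /compact_near_coveringP cK ch.
have := cK R (0^'+) (fun d y => K y ->
  forall z, K z -> `|y - z| < d -> `|h y - h z| < 1) _.
case.
  move=> y Ky.
  have /subspace_continuousP/(_ y Ky) := ch.
  move=> /cvgrPdist_lt/(_ (1/2)) -/(_ ltac:(lra)).
  move=> /nbhs_ballP[e /= e0 He].
  exists (ball y (e / 2), [set d | d < e / 2]).
    split=> /=; first by apply: nbhsx_ballx; rewrite divr_gt0.
    by apply: nbhs_right_lt; rewrite divr_gt0.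
  move=> [y' d] /= [yy' de] Ky' z Kz y'z.
  have h1 : `|h y - h y'| < 1 / 2.
    apply: He => //; apply: le_ball yy'; lra.
  have h2 : `|h y - h z| < 1 / 2.
    apply: He => //; rewrite [e]splitr; apply: ball_triangle yy' _.
    by rewrite -ball_normE /=; exact: lt_trans de.
  have := ler_distD (h y) (h y') (h z).
  rewrite (distrC (h y') (h y)); lra.
move=> e /= e0 He; exists (e / 2) => [|y z Ky Kz]; first exact: divr_gt0.
apply: (He (e / 2)) => //=; last exact: divr_gt0.
rewrite sub0r normrN gtr0_norm ?divr_gt0//; lra.
Qed.

(** Each top cell is assigned to one of the open sets [phi < 1] and [phi > 0]. A cell shared by top
    cells of both kinds goes to the intersection; its dimension is not maximal, whence [m.-1]. *)
Lemma extensive_cover (R : realType) (M : topologicalType) (A : set M)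
    (phi : M -> R) m :
  {within A, continuous phi} -> (forall z, A z -> 0 <= phi z <= 1) ->
  extensive R m (A `&` [set z | phi z < 1]) ->
  extensive R m (A `&` [set z | 0 < phi z]) ->
  extensive R m.-1 (A `&` [set z | 0 < phi z < 1]) ->
  extensive R m A.
Proof.
move=> cphi phi01 eU eV eUV n x D r f r0 Dm cf fA.
have [d d0 Hd] := compact_uniformly_continuous (@compact_box_bd R n x D r)
  (within_continuous_comp_sub cf fA cphi).
have [N N0 Nd] : exists2 N, (0 < N)%N & mesh r N < d.
  exists (Num.truncn (r / d)).+1 => //.
  rewrite /mesh ltr_pdivrMr// mulrC -ltr_pdivrMr//.
  by have /andP[] : ((Num.truncn (r / d))%:R <= r / d < (Num.truncn (r / d)).+1%:R)
    by apply: truncn_itv; rewrite divr_ge0// ltW.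
(* If some boundary point of [Q] has [phi >= 1], then the choice of the mesh forces [phi > 0] at all
   of them. *)
pose low (Q : cell n N) :=
  `[< forall y, cbox x r Q y -> box_bd x D r y -> phi (f y) < 1 >].
have lowN Q : ~~ low Q ->
    forall y, cbox x r Q y -> box_bd x D r y -> 0 < phi (f y).
  move=> /asboolPn/existsNP[y /not_implyP[Qy /not_implyP[bdy /negP]]].
  rewrite -leNgt => phiy z Qz bdz.
  suff : `|phi (f y) - phi (f z)| < 1 by rewrite ltr_norml; lra.
  apply: Hd => //; apply: le_lt_trans Nd.
  apply/ler_rV_norm => [|i]; first by rewrite ltW// mesh_gt0.
  move: Qy Qz => /cboxP/(_ i) + /cboxP/(_ i); rewrite !mxE natrD mulrDl.
  have : (i \in Q.2)%:R * mesh r N <= mesh r N.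
    by rewrite ler_piMl ?lern1 ?leq_b1// ltW// mesh_gt0.
  rewrite ler_norml; lra.
(* The target of a cell obeys the constraints of all the top cells that contain it, which makes
   [Phi] monotone. *)
pose top (c Q : cell n N) :=
  [/\ grid_cell D Q, Q.2 = D & cbox x r c `<=` cbox x r Q].
pose Phi (c : cell n N) := A `&` [set z |
  (forall Q, top c Q -> low Q -> phi z < 1) /\
  (forall Q, top c Q -> ~~ low Q -> 0 < phi z)].
have [|||g [cg gPhi gf]] :=
    @grid_extension R M n x D r N Phi f r0 N0 cf.
- move=> c y gc cy bdy; split; first exact: fA.
  split=> Q [_ _ cQ] lQ; last exact: (lowN _ lQ _ (cQ _ cy)).
  by move/asboolP: lQ; apply=> //; exact: cQ.
- move=> c c' gc gc' c'c z [Az [zlow zhigh]]; split=> //.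
  split=> Q [gQ QD cQ].
    by apply: zlow; split=> //; exact: subset_trans cQ.
  by apply: zhigh; split=> //; exact: subset_trans cQ.
- move=> c gc; have [Q [gQ QD cQ]] := cbox_sub_top x r0 N0 gc.
  have cD : c.2 \subset D by apply/fintype.subsetP; case: gc.
  have cm : (#|c.2|.+1 <= m)%N by apply: leq_ltn_trans Dm; exact: subset_leq_card.
  have [[Q1 cQ1 lQ1]|nlow] := pselect (exists2 Q, top c Q & low Q).
    have [[Q2 cQ2 lQ2]|nhigh] := pselect (exists2 Q, top c Q & ~~ low Q).
      have -> : Phi c = A `&` [set z | 0 < phi z < 1].
        rewrite predeqE => z; split=> [[Az [zl zh]]|[Az /= /andP[z0 z1]]].
          by split=> //=; rewrite (zh Q2)// (zl Q1).
        by split.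
      (* A top cell is contained in no other top cell, so [c] cannot be one, being contained in both
         [Q1] and [Q2]. *)
      apply: extensiveW eUV; suff : (#|c.2| < #|D|)%N by lia.
      rewrite ltn_neqAle subset_leq_card// andbT; apply/eqP => cardc.
      have cDe : c.2 = D by apply/eqP; rewrite eqEcard cD cardc leqnn.
      have [gQ1 Q1D cQ1'] := cQ1; have [gQ2 Q2D cQ2'] := cQ2.
      have c1 := cbox_top_inj r0 N0 gc gQ1 cDe Q1D cQ1'.
      have c2 := cbox_top_inj r0 N0 gc gQ2 cDe Q2D cQ2'.
      by move: lQ2; rewrite -c2 c1 lQ1.
    have -> : Phi c = A `&` [set z | phi z < 1].
      rewrite predeqE => z; split=> [[Az [zl zh]]|[Az /= z1]].
        by split=> //=; exact: zl lQ1.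
      by split=> //; split=> // Q' cQ' lQ'; exfalso; apply: nhigh; exists Q'.
    exact: extensiveW eU.
  have -> : Phi c = A `&` [set z | 0 < phi z].
    rewrite predeqE => z; split=> [[Az [zl zh]]|[Az /= z1]].
      split=> //=; apply: (zh Q) => //.
      by apply/negP => lQ; apply: nlow; exists Q.
    by split=> //; split=> // Q' cQ' lQ'; exfalso; apply: nlow; exists Q'.
  exact: extensiveW eV.
- exists g; split=> // y yB; have [c [gc _ cy]] := cbox_cover r0 N0 yB.
  by have [] := gPhi c y gc cy.
Qed.

(** * Boxes as balls for the sup norm *)

Section Center.
Variables (R : realType) (n : nat) (x : 'rV[R]_n) (D : {set 'I_n}) (r : R).
Hypothesis r_gt0 : 0 < r.

Definition center : 'rV[R]_n := \row_i (x ord0 i + (i \in D)%:R * (r / 2)).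

Let r2 : 0 < r / 2. Proof. exact: divr_gt0. Qed.

Lemma box_normP y : box x D r y <->
  `|y - center| <= r / 2 /\ forall i, i \notin D -> y ord0 i = x ord0 i.
Proof.
have r2' := r2; have r2_ge0 := ltW r2.
split=> [yB|[/(ler_rV_norm _ r2_ge0) yc yD] i].
  split=> [|i iD]; last first.
    by have := yB i; rewrite (negbTE iD) mul0r addr0 -eq_le => /eqP.
  apply/(ler_rV_norm _ r2_ge0) => i; rewrite !mxE ler_norml; have := yB i.
  by case: (i \in D); rewrite ?mul1r ?mul0r => /andP[? ?]; apply/andP; split; lra.
have := yc i; rewrite !mxE ler_norml.
case: (boolP (i \in D)) => iD; rewrite ?mul1r ?mul0r => /andP[? ?].
  by apply/andP; split; lra.
by rewrite yD//; apply/andP; split; lra.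
Qed.

(** The sup norm is attained at some coordinate; off [D] the difference is zero, so at distance
    [r / 2] this coordinate is in [D] and at an end. *)
Lemma box_bd_normP y : box_bd x D r y <-> box x D r y /\ `|y - center| = r / 2.
Proof.
have r2' := r2; have r2_ge0 := ltW r2.
split=> -[yB].
  move=> [i iD yi]; split=> //; have [yc _] := (box_normP y).1 yB.
  apply/eqP; rewrite eq_le yc /=.
  have /(_ i) := (ler_rV_norm (y - center) (normr_ge0 _)).1 (lexx _).
  apply: le_trans; rewrite !mxE iD mul1r.
  case: yi => ->; rewrite ler_normr; apply/orP; [right|left]; lra.
move=> yc; split=> //; have /mx_norm_neq0[[j i] /=] : mx_norm (y - center) != 0.
  by rewrite [mx_norm _]yc gt_eqF.
rewrite [mx_norm _]yc (ord1 j) !mxE => yi; have := yB i.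
case: (boolP (i \in D)) yi => iD; rewrite ?mul1r ?mul0r => yi /andP[yi1 yi2].
  exists i => //; move/eqP: yi; rewrite eq_sym eqr_norml.
  by move=> /andP[/orP[] /eqP yi _]; [right|left]; lra.
have y0 : y ord0 i = x ord0 i by lra.
by move: yi r2'; rewrite y0 addr0 subrr normr0 => ->; rewrite ltxx.
Qed.

End Center.

(* The radial coordinate turns the segments from [z] to [q (p z)] into a collar
   along the boundary, inside which the box carries an extension of [p \o f]. *)
Lemma extensive_dominated (R : realType) (V : finType) (A B : set {ptws V -> R})
    (p q : {ptws V -> R} -> {ptws V -> R}) m :
  {within A, continuous p} -> (forall z, A z -> B (p z)) ->
  {within B, continuous q} -> (forall z, B z -> A (q z)) ->
  (forall z t, A z -> 0 <= t <= 1 -> A (fun v => t * z v + (1 - t) * q (p z) v)) ->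
  extensive R m B -> extensive R m A.
Proof.
move=> cp pB cq qA segA eB n x D r f r0 Dm cf fA.
have [||g [cg gB gpf]] := eB n x D r (p \o f) r0 Dm.
- exact: within_continuous_comp_sub cf fA cp.
- by move=> y /fA /pB.
pose c := center x D r; pose nu y := `|y - c|.
(* Radial projection to the boundary of the box. *)
pose w y := c + (r / 2 / nu y) *: (y - c).
(* The affine function of the radius that is [0] at [r / 4] and [1] at [r / 2]. *)
pose t y := 4 * nu y / r - 1.
(* The concentric box of half size is stretched by [2] onto the whole box. *)
pose Gin y := q (g (c + 2%:R *: (y - c))).
pose Gout y : {ptws V -> R} :=
  fun v => t y * f (w y) v + (1 - t y) * q (p (f (w y))) v.
pose inner := box x D r `&` [set y | nu y <= r / 4].
pose outer := box x D r `&` [set y | r / 4 <= nu y].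
have nu_gt0 y : outer y -> 0 < nu y.
  by move=> [_ /=]; apply: lt_le_trans; exact: divr_gt0.
have w_bd y : outer y -> box_bd x D r (w y).
  move=> /[dup] /nu_gt0 ny [/(box_normP _ _ r0)[_ yD] _].
  have nw : `|w y - c| = r / 2.
    rewrite /w addrAC subrr add0r normrZ normrM normfV normr_id.
    by rewrite mulfVK ?gt_eqF// gtr0_norm// divr_gt0.
  apply/(box_bd_normP _ _ r0); split=> //; apply/(box_normP _ _ r0).
  split=> [|i iD]; first by rewrite nw.
  by rewrite !mxE yD// (negbTE iD) mul0r addr0 subrr mulr0 addr0.
have in_box y : inner y -> box x D r (c + 2%:R *: (y - c)).
  move=> [/(box_normP _ _ r0)[_ yD] /= ny]; apply/(box_normP _ _ r0).
  split=> [|i iD].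
    rewrite addrAC subrr add0r normrZ ger0_norm//.
    by rewrite -/(nu y); lra.
  by rewrite !mxE yD// (negbTE iD) mul0r addr0 subrr mulr0 addr0.
have cy S : {within S, continuous (fun y => y - c)}.
  apply: within_continuousD; last exact: within_continuous_cst.
  by apply: continuous_subspaceT => y; exact: cvg_id.
have cnu S : {within S, continuous nu} by exact: within_continuous_norm.
have cnuT : continuous nu by apply/continuous_subspace_setT; exact: cnu.
have closed_in : closed inner.
  apply: closedI; first exact: closed_box.
  by apply: (@closed_comp _ _ nu [set u | u <= r / 4]) => //; exact: closed_le.
have closed_out : closed outer.
  apply: closedI; first exact: closed_box.
  by apply: (@closed_comp _ _ nu [set u | r / 4 <= u]) => //; exact: closed_ge.
have box_inout : box x D r = inner `|` outer.
  rewrite predeqE => y; split=> [yB|[[]|[]]//].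
  by have [?|/ltW ?] := leP (nu y) (r / 4); [left|right].
have cin : {within inner, continuous Gin}.
  have ca : {within inner, continuous (fun y => c + 2%:R *: (y - c))}.
    apply: within_continuousD; first exact: within_continuous_cst.
    by apply: within_continuousZ; first exact: within_continuous_cst.
  have := within_continuous_comp_sub
    (within_continuous_comp_sub ca in_box cg) _ cq.
  by apply=> y /in_box/gB.
have cw : {within outer, continuous w}.
  apply: within_continuousD; first exact: within_continuous_cst.
  apply: within_continuousZ => //.
  apply: within_continuousM; first exact: within_continuous_cst.
  by apply: within_continuousV => // y /nu_gt0 /gt_eqF ->.
have cfw := within_continuous_comp_sub cw w_bd cf.
have cqp : {within outer, continuous (fun y => q (p (f (w y))))}.
  have := within_continuous_comp_sub (within_continuous_comp_sub cfw _ cp) _ cq.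
  by apply=> y /w_bd /fA //; exact: pB.
have cout : {within outer, continuous Gout}.
  have ct : {within outer, continuous t}.
    apply: within_continuousD; last exact: within_continuous_cst.
    apply: within_continuousM; last exact: within_continuous_cst.
    by apply: within_continuousM => //; exact: within_continuous_cst.
  apply/within_ptws_continuousP => v.
  apply: within_continuousD; apply: within_continuousM => //.
  - exact: (within_ptws_continuousP _ _).1 cfw v.
  - apply: within_continuousD; first exact: within_continuous_cst.
    exact: within_continuousN.
  - exact: (within_ptws_continuousP _ _).1 cqp v.
pose G y := if nu y <= r / 4 then Gin y else Gout y.
(* At radius [r / 4] stretching by [2] is the projection [w], so both sides are
   [q (p (f (w y)))]. *)
have Gin_out y : nu y = r / 4 -> outer y -> Gin y = Gout y.
  move=> ny yo; have t0 : t y = 0 by rewrite /t ny; field; lra.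
  apply/funext => v; rewrite /Gout t0 mul0r add0r subr0 mul1r /Gin.
  have -> : c + 2%:R *: (y - c) = w y.
    by rewrite /w ny; congr (_ + _ *: _); field; lra.
  by rewrite gpf//; exact: w_bd.
exists G; split.
- rewrite box_inout; apply: withinU_continuous => //.
    by apply: within_continuous_eq cin => y [_ /=]; rewrite /G => ->.
  apply: within_continuous_eq cout => y yo; rewrite /G; case: ifP => // ny.
  by rewrite Gin_out//; apply/eqP; rewrite eq_le ny; case: yo.
- move=> y yB; rewrite /G; case: leP => ny.
    by apply/qA/gB/in_box.
  have yo : outer y by split=> //; exact: ltW.
  apply: segA; first exact/fA/w_bd.
  have [yc _] := (box_normP x D r0 y).1 yB; rewrite -/(nu y) in yc.
  by rewrite /t subr_ge0 lerBlDr ler_pdivlMr// ler_pdivrMr//;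
    apply/andP; split; lra.
- move=> y bdy; have [yB ny] := (box_bd_normP _ _ r0 _).1 bdy.
  rewrite /G -/(nu y); case: leP => [|_].
    by rewrite /nu ny => ny4; exfalso; lra.
  have t1 : t y = 1 by rewrite /t /nu ny; field; lra.
  have wy : w y = y.
    by rewrite /w /nu ny divff ?gt_eqF ?divr_gt0// scale1r addrC subrK.
  by apply/funext => v; rewrite /Gout t1 wy mul1r subrr mul0r addr0.
Qed.

(** * Polyhedra *)

Section Polyhedron.
Variables (R : realType) (V : finType).
Implicit Types (S : {set V} -> bool) (z y : {ptws V -> R}) (a v : V).

Definition supp z : {set V} := finset (fun v => z v != 0).

(** [S] may contain the empty set, as links do: coordinates of sum [1] never have empty support. *)
Definition polyhedron S : set {ptws V -> R} :=
  [set z | (forall v, 0 <= z v) /\ \sum_(v : V) z v = 1 /\ S (supp z)].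

Definition vertex_point a : {ptws V -> R} := fun v => (v == a)%:R.

Lemma supp_vertex_point a : supp (vertex_point a) = [set a]%SET.
Proof.
by apply/setP => v; rewrite !inE /vertex_point pnatr_eq0 eqb0 negbK.
Qed.

Lemma polyhedron_vertex_point S a : S [set a]%SET -> polyhedron S (vertex_point a).
Proof.
move=> Sa; split=> [v|]; first by rewrite /vertex_point ler0n.
split; last by rewrite supp_vertex_point.
rewrite (bigD1 a)//= big1 ?addr0 /vertex_point ?eqxx// => v.
by move=> /negbTE ->.
Qed.

Lemma polyhedron_le1 S z a : polyhedron S z -> z a <= 1.
Proof.
move=> [z0 [<- _]]; rewrite (bigD1 a)//= lerDl.
by apply: sumr_ge0 => v _.
Qed.

(** The support of a point strictly inside the segment is the union of the supports of the ends. *)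
Lemma polyhedron_segment S z y t : polyhedron S z -> polyhedron S y ->
  S (supp z :|: supp y)%SET -> 0 <= t <= 1 ->
  polyhedron S (fun v => t * z v + (1 - t) * y v).
Proof.
move=> [z0 [z1 Sz]] [y0 [y1 Sy]] Szy /andP[t0 t1].
split=> [v|]; first by rewrite addr_ge0// mulr_ge0// subr_ge0.
split; first by rewrite big_split/= -!mulr_sumr z1 y1; ring.
have [->|tn0] := eqVneq t 0.
  by congr S: Sy; apply/setP => v; rewrite !inE mul0r add0r subr0 mul1r.
have [->|tn1] := eqVneq t 1.
  by congr S: Sz; apply/setP => v; rewrite !inE subrr mul0r addr0 mul1r.
congr S: Szy; apply/setP => v; rewrite !inE.
have t0' : 0 < t by rewrite lt_def tn0.
have t1' : 0 < 1 - t by rewrite subr_gt0 lt_neqAle tn1.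
have tz : 0 <= t * z v by exact: mulr_ge0.
have ty : 0 <= (1 - t) * y v by apply: mulr_ge0 => //; exact: ltW.
by rewrite (paddr_eq0 tz ty) !mulf_eq0 (gt_eqF t0') (gt_eqF t1') negb_and.
Qed.

Lemma extensive_vertex_point m a : extensive R m [set vertex_point a].
Proof.
move=> n x D r f _ _ _ fa; exists (fun=> vertex_point a); split=> //.
  by move=> y; exact: cvg_cst.
by move=> y /fa.
Qed.

(** A set that is star-shaped about a vertex is dominated by that single point. *)
Lemma extensive_star (A : set {ptws V -> R}) a m : A (vertex_point a) ->
  (forall z t, A z -> 0 <= t <= 1 ->
     A (fun v => t * z v + (1 - t) * vertex_point a v)) ->
  extensive R m A.
Proof.
move=> Aa starA.
apply: (@extensive_dominated R V A [set vertex_point a]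
  (fun=> vertex_point a) id).
- by move=> y; exact: cvg_cst.
- by [].
- by apply: continuous_subspaceT => y; exact: cvg_id.
- by move=> _ ->.
- exact: starA.
- exact: extensive_vertex_point.
Qed.

Lemma extensive_cone S a m : S [set a]%SET ->
  (forall s, S s -> S (a |: s)%SET) -> extensive R m (polyhedron S).
Proof.
move=> Sa coneS; have Ga := polyhedron_vertex_point Sa.
apply: (extensive_star Ga) => z t Gz t01; apply: polyhedron_segment => //.
by rewrite supp_vertex_point finset.setUC; apply: coneS; case: Gz => _ [].
Qed.

(** * Gluing a cone over the link of a vertex *)

(** Radial projection from the vertex [a] to the opposite face, meaningful for [z a < 1]. *)
Definition project a z : {ptws V -> R} :=
  fun v => if v == a then 0 else z v / (1 - z a).

(** The midpoint between [z] and the vertex [a], for [z a = 0]. *)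
Definition halfway a z : {ptws V -> R} :=
  fun v => if v == a then 1 / 2 else z v / 2.

Lemma coord_ptws_continuous v : continuous (fun z : {ptws V -> R} => z v).
Proof. exact: (@proj_continuous V (fun=> R) v). Qed.

Lemma project_continuous a (A : set {ptws V -> R}) :
  (forall z, A z -> z a < 1) -> {within A, continuous (project a)}.
Proof.
move=> A1; apply/within_ptws_continuousP => v; rewrite /project.
case: eqP => _; first exact: within_continuous_cst.
have cc w := continuous_subspaceT (@coord_ptws_continuous w) :
  {within A, continuous _}.
apply: within_continuousM => //; apply: within_continuousV.
  by move=> z /A1; lra.
apply: within_continuousD; first exact: within_continuous_cst.
exact: within_continuousN.
Qed.

Lemma halfway_continuous a (A : set {ptws V -> R}) :
  {within A, continuous (halfway a)}.
Proof.
apply/within_ptws_continuousP => v; rewrite /halfway.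
case: eqP => _; first exact: within_continuous_cst.
have cc w := continuous_subspaceT (@coord_ptws_continuous w) :
  {within A, continuous _}.
by apply: within_continuousM => //; exact: within_continuous_cst.
Qed.

Lemma supp_project a z : z a < 1 -> supp (project a z) = (supp z :\ a)%SET.
Proof.
move=> z1; apply/setP => v; rewrite !inE /project.
case: (eqVneq v a) => _ /=; first by rewrite eqxx.
by rewrite mulf_eq0 invr_eq0 (gt_eqF (_ : 0 < 1 - z a)) ?orbF ?subr_gt0.
Qed.

Lemma supp_halfway a z : supp (halfway a z) = (a |: supp z)%SET.
Proof.
apply/setP => v; rewrite !inE /halfway.
case: (eqVneq v a) => _ /=; first by rewrite mul1r invr_eq0 pnatr_eq0.
by rewrite mulf_eq0 invr_eq0 pnatr_eq0 orbF.
Qed.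

Lemma polyhedron_project S S' a z : polyhedron S z -> z a < 1 ->
  S' (supp z :\ a)%SET -> polyhedron S' (project a z).
Proof.
move=> [z0 [zs Sz]] z1 S'z; split=> [v|].
  by rewrite /project; case: eqP => // _; rewrite divr_ge0// subr_ge0 ltW.
split; last by rewrite supp_project.
rewrite (bigD1 a)//= {1}/project eqxx add0r.
rewrite (eq_bigr (fun v => z v / (1 - z a))); last first.
  by move=> v /negbTE va; rewrite /project va.
rewrite -mulr_suml; have -> : \sum_(i | i != a) z i = 1 - z a.
  by rewrite -zs [X in _ = X - _](bigD1 a)//= addrAC subrr add0r.
by rewrite divff// gt_eqF// subr_gt0.
Qed.

Lemma polyhedron_halfway S S' a z : polyhedron S z -> z a = 0 ->
  S' (a |: supp z)%SET -> polyhedron S' (halfway a z).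
Proof.
move=> [z0 [zs Sz]] za S'z; split=> [v|].
  by rewrite /halfway; case: eqP => // _; rewrite divr_ge0.
split.
  rewrite (bigD1 a)//= {1}/halfway eqxx.
  rewrite (eq_bigr (fun v => z v / 2)); last first.
    by move=> v /negbTE va; rewrite /halfway va.
  rewrite -mulr_suml; have -> : \sum_(i | i != a) z i = 1.
    by rewrite -zs [RHS](bigD1 a)//= za add0r.
  by rewrite -splitr.
by rewrite supp_halfway.
Qed.

Lemma convex_gt0 (t u w : R) : 0 <= t <= 1 -> 0 < u -> 0 < w ->
  0 < t * u + (1 - t) * w.
Proof.
move=> /andP[t0 t1] u0 w0; have [->|tn0] := eqVneq t 0.
  by rewrite mul0r add0r subr0 mul1r.
have t_gt0 : 0 < t by rewrite lt_def tn0.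
apply: ltr_pwDl; first exact: mulr_gt0.
by apply: mulr_ge0; [rewrite subr_ge0|exact: ltW].
Qed.

(** The coordinate at [a] gives an open cover: [z a < 1] deforms to the deletion of [a], [z a > 0]
    is star-shaped about [a], and their intersection deforms to a copy of the link. *)
Lemma extensive_glue S a m :
  (forall s t : {set V}, S t -> s \subset t -> S s) -> S [set a]%SET ->
  extensive R m (polyhedron (fun s : {set V} => (a \notin s) && S s)) ->
  extensive R m.-1 (polyhedron (fun s : {set V} => (a \notin s) && S (a |: s)%SET)) ->
  extensive R m (polyhedron S).
Proof.
move=> Ssub Sa edel elink.
have supp0 z : a \notin supp z -> z a = 0 by rewrite inE negbK => /eqP.
apply: (extensive_cover (phi := fun z => z a)) => //.
- exact/continuous_subspaceT/coord_ptws_continuous.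
- by move=> z Gz; rewrite (polyhedron_le1 _ Gz) andbT; case: Gz.
- apply: (extensive_dominated (p := project a) (q := id)) edel.
  + by apply: project_continuous => z [].
  + move=> z [Gz z1]; have Sz := Gz.2.2; apply: polyhedron_project Gz z1 _.
    rewrite !inE eqxx /=.
    by apply: Ssub Sz _; exact: subD1set.
  + by apply: continuous_subspaceT => y; exact: cvg_id.
  + move=> z [z0 [zs /andP[az Sz]]]; split; first by split.
    by rewrite /= supp0.
  + move=> z t [Gz z1] t01; split; last first.
      rewrite /= /project eqxx mulr0 addr0; apply: le_lt_trans z1.
      by rewrite ler_piMl//; [exact: Gz.1|case/andP: t01].
    have Sz := Gz.2.2.
    apply: polyhedron_segment => //.
      apply: (polyhedron_project Gz z1).
      by apply: Ssub Sz _; exact: subD1set.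
    by rewrite supp_project// (finset.setUidPl _)// subD1set.
- apply: (extensive_star (a := a)).
    split; first exact: polyhedron_vertex_point.
    by rewrite /= /vertex_point eqxx.
  move=> z t [Gz /= z0] t01; split; last first.
    by rewrite /= /vertex_point eqxx; apply: convex_gt0.
  apply: polyhedron_segment => //; first exact: polyhedron_vertex_point.
  rewrite supp_vertex_point (finset.setUidPl _); first by case: Gz => _ [].
  by rewrite finset.sub1set inE gt_eqF.
(* The link itself lies at [z a = 0], outside the intersection, so it is embedded at the level
   [1 / 2]. *)
- apply: (extensive_dominated (p := project a) (q := halfway a)) elink.
  + by apply: project_continuous => z [_ /andP[]].
  + move=> z [Gz /andP[z0 z1]]; have Sz := Gz.2.2.
    apply: polyhedron_project Gz z1 _.
    by rewrite !inE eqxx /= finset.setD1K// inE gt_eqF.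
  + exact: halfway_continuous.
  + move=> z Gz; have [_ [_ /andP[az Sz]]] := Gz; split.
      exact: polyhedron_halfway Gz (supp0 _ az) Sz.
    by rewrite /= /halfway eqxx; lra.
  + move=> z t [Gz /andP[z0 z1]] t01; have Sz := Gz.2.2.
    have az : a \in supp z by rewrite inE gt_eqF.
    split; last first.
      rewrite /= /halfway eqxx; have h : 0 < 1 / 2 :> R by lra.
      have := convex_gt0 t01 (_ : 0 < 1 - z a) h; rewrite subr_gt0 => /(_ z1) ?.
      by rewrite convex_gt0//=; lra.
    have Gp : polyhedron (fun s : {set V} => (a \notin s) && S (a |: s)%SET)
        (project a z).
      by apply: (polyhedron_project Gz z1); rewrite !inE eqxx /= finset.setD1K.
    have pa : project a z a = 0 by rewrite /project eqxx.
    have sq : supp (halfway a (project a z)) = supp z.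
      by rewrite supp_halfway supp_project// finset.setD1K.
    apply: polyhedron_segment => //; last by rewrite sq finset.setUid.
    apply: polyhedron_halfway Gp pa _.
    by rewrite supp_project// finset.setD1K.
Qed.

End Polyhedron.
Arguments polyhedron R {V} S.

Lemma eq_polyhedron (R : realType) (V : finType) (S S' : {set V} -> bool) :
  S =1 S' -> polyhedron R S = polyhedron R S'.
Proof. by move=> SS'; congr polyhedron; apply/funext. Qed.

(** * Joins of discrete sets *)

Definition partial_transversal (V I : finType) (k : V -> I) (C s : {set V}) :=
  (s \subset C) && (#|imset k (mem s)| == #|s|).

Lemma partial_transversalP (V I : finType) (k : V -> I) (C s : {set V}) :
  reflect ({subset s <= C} /\ {in s &, injective k}) (partial_transversal k C s).
Proof.
by apply: (iffP andP) => -[/fintype.subsetP sC /imset_injP ki]; split.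
Qed.

(* The complex of partial transversals is the join of the fibers of [k], seen as
   discrete sets. *)
Lemma extensive_partial_transversal (R : realType) (V I : finType) (k : V -> I)
    (C : {set V}) m : (m <= #|imset k (mem C)|)%N ->
  extensive R m (polyhedron R (partial_transversal k C)).
Proof.
have [n Cn] := ubnP #|C|; elim: n C Cn m => [//|n IHn] C Cn [|m] mC.
  by move=> ? ? ? ? ?; rewrite ltn0.
have [a aC] : exists a, a \in C.
  apply/finset.set0Pn; apply: contraTneq mC => ->.
  by rewrite imset0 cards0.
have ptW (s t : {set V}) : partial_transversal k C t -> s \subset t ->
    partial_transversal k C s.
  move=> /partial_transversalP[tC ti] /fintype.subsetP st.
  apply/partial_transversalP; split=> [u /st /tC //|u v us vs].
  by apply: ti; exact: st.
have pt1 : partial_transversal k C [set a]%SET.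
  apply/partial_transversalP; split=> [u|u v]; rewrite !inE.
    by move=> /eqP ->.
  by move=> /eqP -> /eqP ->.
(* If [b] shares the fiber of [a], deleting [a] keeps every fiber nonempty. *)
have [[b bC [ba kb]]|nomate] := pselect (exists2 b, b \in C & b != a /\ k b = k a).
  apply: (extensive_glue ptW pt1).
    rewrite (@eq_polyhedron _ _ _ (partial_transversal k (C :\ a)%SET)); last first.
      by move=> s; rewrite /partial_transversal finset.subsetD1 andbCA andbA.
    apply: IHn; first by move: Cn; rewrite (cardsD1 a) aC.
    apply: leq_trans mC _; apply/subset_leq_card/fintype.subsetP => i.
    move=> /imsetP[c cC ->].
    have [->|ca] := eqVneq c a.
      by apply/imsetP; exists b; rewrite // !inE ba.
    by apply/imsetP; exists c; rewrite // !inE ca.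
  (* The link of [a] is the join of the other fibers, one fewer, which matches the drop from [m.+1]
     to [m]. *)
  pose C' := finset (fun v => (v \in C) && (k v != k a)).
  rewrite (@eq_polyhedron _ _ _ (partial_transversal k C')); last first.
    move=> s; apply/andP/partial_transversalP.
      move=> [as_ /partial_transversalP[sC si]]; split=> [u us|u v us vs].
        rewrite inE sC ?inE ?us ?orbT//=; apply: contra as_ => /eqP ka.
        by rewrite -(si u a _ _ ka) ?inE ?us ?eqxx ?orbT.
      by apply: si; rewrite !inE ?us ?vs orbT.
    move=> [sC' si]; have as_ : a \notin s.
      by apply/negP => /sC'; rewrite inE eqxx andbF.
    split=> //; apply/partial_transversalP; split=> [u|u v]; rewrite !inE.
      by move=> /orP[/eqP -> //|/sC']; rewrite inE => /andP[].
    move=> /orP[/eqP ->|us] /orP[/eqP ->|vs] //.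
    - by move: vs => /sC'; rewrite inE => /andP[_ /eqP kv] /esym.
    - by move: us => /sC'; rewrite inE => /andP[_ /eqP kv] /kv.
    - exact: si.
  apply: IHn.
    move: Cn; rewrite ltnS; apply: leq_trans; apply: proper_card.
    apply/properP; split.
      by apply/fintype.subsetP => v; rewrite inE => /andP[].
    by exists a => //; rewrite inE eqxx andbF.
  rewrite -ltnS; apply: leq_trans mC _.
  have : imset k (mem C) \subset (k a |: imset k (mem C'))%SET.
    apply/fintype.subsetP => i /imsetP[c cC ->]; rewrite !inE.
    have [//|kc] := eqVneq (k c) (k a).
    by apply/imsetP; exists c; rewrite // inE cC.
  move=> /subset_leq_card /leq_trans; apply.
  by rewrite cardsU1 -add1n leq_add2r leq_b1.
(* Alone in its fiber, [a] can be added to every partial transversal, so the complex is a cone. *)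
apply: (extensive_cone pt1) => s /partial_transversalP[sC si].
have inja u : u \in C -> k u = k a -> u = a.
  by move=> uC ku; apply: contrapT => /eqP ua; apply: nomate; exists u.
apply/partial_transversalP; split=> [u|u v]; rewrite !inE.
  by move=> /orP[/eqP ->|/sC].
move=> /orP[/eqP ->|us] /orP[/eqP ->|vs] //.
- by move=> /esym /inja ->//; exact: sC.
- by move=> /inja ->//; exact: sC.
- exact: si.
Qed.

(** * Links of forests and the Morse complex *)

Section Main.
Variables (R : realType) (T : finType) (G : complex T).
Hypothesis Ggraph : is_graph G.
Local Notation arc := ({set T} * {set T})%type.

(** For [A] disjoint from [F], these are the simplices in [A] of the link of [F], together with the
    empty set. *)
Definition forest_link (F A s : {set arc}) : bool :=
  (s \subset A) && forest G (F :|: s)%SET.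

Lemma extensive_link m (F A : {set arc}) :
  forest G F -> free_arcs G F \subset A ->
  (0 < m -> m.-1 * max_hasse_degree G < #|free_arcs G F|)%N ->
  extensive R m (polyhedron R (forest_link F A)).
Proof.
elim: m F A => [|m IHm] F A fF FA Fm; first by move=> ? ? ? ? ?; rewrite ltn0.
(* Inner induction on the number of arcs of [A] that are not free. *)
have [n An] := ubnP #|A :\: free_arcs G F|%SET.
elim: n A An FA => [//|n IHn] A An FA.
have [AF|] := boolP (A \subset free_arcs G F).
  have {An} <- : free_arcs G F = A by apply/eqP; rewrite finset.eqEsubset FA AF.
  rewrite (@eq_polyhedron _ _ _
    (partial_transversal (@arc_tail T) (free_arcs G F))); last first.
    move=> s; apply/andP/partial_transversalP => [[sF fs]|[/fintype.subsetP sF si]].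
      split; first exact/fintype.subsetP.
      move=> u v us vs; apply: (forest_tail_inj fs); by rewrite !inE ?us ?vs orbT.
    by split=> //; apply: (forest_union Ggraph fF sF).
  apply: extensive_partial_transversal.
  (* Cancelling the degree leaves more than [m] tails, hence at least [m.+1] fibers. *)
  have := leq_trans (Fm isT) (card_free_tails Ggraph F).
  by rewrite ltn_mul2r => /andP[].
move=> /subsetPn[a aA aF].
have IHA : extensive R m.+1 (polyhedron R (forest_link F (A :\ a)%SET)).
  apply: IHn.
    move: An; rewrite ltnS; apply: leq_trans; apply: proper_card.
    apply/properP; split.
      by apply: finset.setSD; exact: subD1set.
    by exists a; rewrite finset.in_setD ?aF ?aA// finset.in_setD1 eqxx andbF.
  by rewrite finset.subsetD1 FA aF.
have [fa|nfa] := boolP (forest G (a |: F)%SET); last first.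
  rewrite (@eq_polyhedron _ _ _ (forest_link F (A :\ a)%SET))//.
  move=> s; rewrite /forest_link finset.subsetD1 -andbA; congr (_ && _).
  have [as_|//] := boolP (a \in s); rewrite /=.
  apply/negP => fs; case/negP: nfa; apply: forestW fs _.
  by rewrite finset.subUset finset.sub1set inE as_ orbT finset.subsetUl.
apply: (@extensive_glue R _ _ a).
- move=> s t /andP[tA ft] st; rewrite /forest_link (fintype.subset_trans st tA).
  by apply: forestW ft _; exact: finset.setUS.
- by rewrite /forest_link finset.sub1set aA finset.setUC.
- rewrite (@eq_polyhedron _ _ _ (forest_link F (A :\ a)%SET))//.
  by move=> s; rewrite /forest_link finset.subsetD1 andbA [_ && (_ \subset _)]andbC.
(* The link of [a] in the link of [F] is the link of the enlarged forest, to which the outer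
   induction applies. *)
rewrite (@eq_polyhedron _ _ _ (forest_link (a |: F) (A :\ a))%SET); last first.
  move=> s; rewrite /forest_link finset.subsetD1 finset.subUset finset.sub1set aA /=.
  by rewrite finset.setUCA finset.setUA andbA [_ && (_ \subset _)]andbC.
apply: IHm => // [|m0].
  apply/fintype.subsetP => q qF'; rewrite !inE.
  have /andP[qa qF] : (q != a) && (q \in free_arcs G F).
    move: qF'; rewrite !inE imsetU1 !inE => /and3P[/andP[-> ->]].
    rewrite !negb_or => /andP[tq ->] /andP[_ ->]; rewrite !andbT.
    by apply: contraNneq tq => ->.
  by rewrite qa (fintype.subsetP FA).
(* At most one degree's worth of free arcs is lost, and the outer induction lowers the required
   bound by exactly one degree. *)
have := Fm isT; have := card_free Ggraph F a.
case: m m0 {IHn Fm IHA} => [//|m] _ /=; rewrite mulSn => le_card lt_card.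
by rewrite -(ltn_add2r (max_hasse_degree G)) addnC; apply: leq_trans lt_card _.
Qed.

(** The Morse complex is the link of the empty forest, whose free arcs are all the upward arcs. *)
Lemma extensive_morse m :
  (0 < m -> m.-1 * max_hasse_degree G < nb_edges G)%N ->
  extensive R m (realization R (morse_complex G)).
Proof.
move=> mE.
have -> : realization R (morse_complex G) =
    polyhedron R (forest_link finset.set0 finset.setT).
  rewrite predeqE => z; split=> -[z0 [z1 Sz]]; split=> //; split=> //.
    rewrite /forest_link finset.subsetT finset.set0U forest_morse// -/(supp z).
    apply: contraTneq Sz => s0; rewrite -/(supp z) s0.
    exact: simplex_neq0.
  move: Sz; rewrite /forest_link finset.subsetT finset.set0U /= forest_morse//.
  apply/negP => /eqP s0.
  move: z1; rewrite big1 => [|v _]; first by move=> /eqP; rewrite eq_sym oner_eq0.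
  by have /setP/(_ v) := s0; rewrite !inE => /negbFE/eqP.
apply: extensive_link; [exact: forest_set0|exact: finset.subsetT|].
rewrite free_set0 => m0; apply: leq_trans (mE m0) _; exact: card_upward.
Qed.

End Main.

(** * Homotopy groups *)

Lemma within_set_type_continuous (X Y : topologicalType) (A : set Y) (S : set X)
    (h : X -> A) :
  {within S, continuous (fun x => set_val (h x))} -> {within S, continuous h}.
Proof.
move=> /continuousP ch; apply/(@continuousP _ (initial_topology set_val)).
by move=> _ [B oB <-]; exact: ch B oB.
Qed.

Section Spheres.
Variables (R : realType) (V : finType) (A : set {ptws V -> R}).
Let M : topologicalType := A.

(** In dimension [0] the boundary of the box is empty, so extending the empty map produces a point
    of [A]. *)
Lemma extensive_nonempty : extensive R 1 A -> A !=set0.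
Proof.
move=> eA; have [||y [_ [[]]]//|g [_ gA _]] :=
    eA 0 0 finset.set0 1 (fun _ _ => 0) ltr01.
- by rewrite cards0.
- by move=> y; exact: cvg_cst.
- by exists (g 0); apply: gA => -[].
Qed.

(** The default [x0] is taken only outside [A]. *)
Definition lift_set (x0 : M) (z : {ptws V -> R}) : M :=
  if pselect (A z) is left Az then exist _ z (mem_set Az) else x0.

Lemma set_val_lift x0 z : A z -> set_val (lift_set x0 z) = z.
Proof. by rewrite /lift_set; case: pselect. Qed.

(** A null-homotopy of [f] is a map on the cube of dimension [k + 1] with prescribed boundary
    values: [f] on the bottom face and [x0] on all others. *)
Lemma extensive_pi_trivial k (x0 : M) : extensive R k.+2 A -> @pi_trivial R M k x0.
Proof.
move=> eA f [cf fbd].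
pose last_coord (y : 'rV[R]_(k + 1)) := y ord0 (rshift k ord0).
pose init (y : 'rV[R]_(k + 1)) : 'rV[R]_k := lsubmx y.
pose z0 (n : nat) : 'rV[R]_n := 0.
pose full n : {set 'I_n} := finset.setT.
have boxE n y : box (z0 n) (full n) 1 y <-> cube y.
  by split=> H i; have := H i; rewrite mxE inE mul1r add0r.
have box_bdE n y : box_bd (z0 n) (full n) 1 y <-> cube_boundary y.
  split=> -[/boxE yc].
    by move=> [i _]; rewrite mxE add0r => ?; split=> //; exists i.
  by move=> [i yi]; split=> //; exists i; rewrite ?inE// mxE add0r.
have clast : continuous last_coord by exact: coord_continuous.
have cinit : continuous init.
  apply/continuous_subspace_setT; apply: within_row_continuous => i.
  apply: continuous_subspaceT => y; rewrite /init.
  have -> : (fun y : 'rV[R]_(k + 1) => lsubmx y ord0 i) =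
            (fun y => y ord0 (lshift 1 i)) by apply/funext => ?; rewrite mxE.
  exact: coord_continuous.
have init_cube y : cube y -> cube (init y).
  by move=> yc i; rewrite mxE; exact: yc.
pose F y := if last_coord y == 0 then set_val (f (init y)) else set_val x0.
pose bd := box_bd (z0 (k + 1)%N) (full (k + 1)%N) 1.
pose bottom := bd `&` [set y | last_coord y = 0].
pose side := bd `&` ([set y | last_coord y = 1] `|`
  init @^-1` (box_bd (z0 k) (full k) 1)).
have cval : continuous (set_val : M -> {ptws V -> R}).
  exact: initial_continuous.
have bdE : bd = bottom `|` side.
  rewrite predeqE => y; split=> [ybd|[[]//|[]//]].
  have [yB [i _ yi]] := ybd.
  rewrite mxE add0r in yi.
  have [j|j] := fintype.splitP i.
    move=> ij; right; split=> //; right => /=; apply/box_bdE; split.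
      by apply/init_cube/boxE.
    exists j; rewrite mxE.
    by have -> : lshift 1 j = i by exact: val_inj.
  rewrite (ord1 j) => ij; have li : rshift k ord0 = i by exact: val_inj.
  by case: yi => yi; [left|right]; split=> //=; [|left]; rewrite /last_coord li.
(* Where the bottom meets a lateral face the prescriptions agree, because [f] is [x0] on the
   boundary of its cube. *)
have Fside y : side y -> F y = set_val x0.
  move=> [_ /= [y1|/box_bdE yb]]; rewrite /F; first by rewrite y1 oner_eq0.
  by rewrite (fbd _ yb); case: ifP.
have cF : {within bd, continuous F}.
  rewrite bdE; apply: withinU_continuous.
  - apply: closedI; first exact: closed_box_bd.
    by apply: (@closed_comp _ _ last_coord [set u | u = 0]) => //; exact: closed_eq.
  - apply: closedI; first exact: closed_box_bd.
    apply: closedU.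
      by apply: (@closed_comp _ _ last_coord [set u | u = 1]) => //; exact: closed_eq.
    by apply: closed_comp => //; exact: closed_box_bd.
  - apply: (@within_continuous_eq _ _ _ (set_val \o (f \o init))).
      by move=> y [_ /= y0]; rewrite /F y0 eqxx.
    apply: (within_continuous_comp_sub (B := setT)) => //; last first.
      exact: continuous_subspaceT.
    apply: (within_continuous_comp_sub (B := @cube R k)) => //.
      exact: continuous_subspaceT.
    by move=> y [[/boxE yc _] _]; exact: init_cube.
  - apply: (@within_continuous_eq _ _ _ (fun=> set_val x0)).
      by move=> y /Fside.
    by move=> y; exact: cvg_cst.
have FA y : A (F y) by rewrite /F; case: ifP => _; exact: set_valP.
have [|||g [cg gA gF]] := eA _ (z0 (k + 1)%N) (full (k + 1)%N) 1 F ltr01.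
- by rewrite cardsT card_ord addn1.
- exact: cF.
- by move=> y _; exact: FA.
(* The time parameter becomes the last coordinate. *)
pose join (xt : 'rV[R]_k * R) : 'rV[R]_(k + 1) := row_mx xt.1 (const_mx xt.2).
have init_join x t : init (join (x, t)) = x by exact: row_mxKl.
have last_join x t : last_coord (join (x, t)) = t.
  by rewrite /last_coord row_mxEr mxE.
have join_box x t : cube x -> 0 <= t <= 1 -> box (z0 _) (full _) 1 (join (x, t)).
  move=> xc t01; apply/boxE => i; rewrite mxE.
  by case: fintype.splitP => j _; [exact: xc|rewrite mxE].
have cjoin : continuous join.
  apply/continuous_subspace_setT; apply: within_row_continuous => i.
  apply: continuous_subspaceT; rewrite /join.
  case: (fintype.splitP i) => j ij.
    have -> : (fun xt : 'rV[R]_k * R => row_mx xt.1 (const_mx xt.2) ord0 i) =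
        (fun xt => xt.1 ord0 j).
      apply/funext => xt; have -> : i = lshift 1 j by exact: val_inj.
      by rewrite row_mxEl.
    move=> xt; apply: (@continuous_comp _ _ _ fst (fun y : 'rV[R]_k => y ord0 j)).
      exact: cvg_fst.
    exact: coord_continuous.
  have -> : (fun xt : 'rV[R]_k * R => row_mx xt.1 (const_mx xt.2) ord0 i) =
      (fun xt => xt.2).
    apply/funext => xt; have -> : i = rshift k j by exact: val_inj.
    by rewrite row_mxEr mxE.
  by move=> xt; exact: cvg_snd.
have join_end x t : cube x -> t = 0 \/ t = 1 -> bd (join (x, t)).
  move=> xc t01; apply/box_bdE; split.
    by apply/boxE/join_box => //; case: t01 => ->; rewrite lexx ler01.
  by exists (rshift k ord0); rewrite -/(last_coord _) last_join.
have join_side x t : cube_boundary x -> 0 <= t <= 1 -> side (join (x, t)).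
  move=> [xc [i xi]] t01; split; last first.
    by right; rewrite /= init_join; apply/box_bdE; split=> //; exists i.
  apply/box_bdE; split; first by apply/boxE/join_box.
  by exists (lshift 1 i); rewrite /join row_mxEl.
have lift_eq (z : M) w : w = set_val z -> lift_set x0 w = z.
  by move=> ->; apply: val_inj; exact: set_val_lift (set_valP z).
exists (fun xt => lift_set x0 (g (join xt))); split.
- apply: within_set_type_continuous.
  apply: (@within_continuous_eq _ _ _ (g \o join)).
    move=> [x t] [/= xc]; rewrite in_itv /= => t01; rewrite set_val_lift//.
    exact/gA/join_box.
  apply: (within_continuous_comp_sub _ _ cg); first exact: continuous_subspaceT.
  by move=> [x t] [/= xc]; rewrite in_itv /= => t01; exact: join_box.
- move=> x xc; apply: lift_eq; rewrite gF; last by apply: join_end => //; left.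
  by rewrite /F last_join eqxx init_join.
- move=> x xc; apply: lift_eq; rewrite gF; last by apply: join_end => //; right.
  by rewrite /F last_join oner_eq0.
- move=> x t xb t01; apply: lift_eq; have xs := join_side x t xb t01.
  by rewrite gF ?Fside//; case: xs.
Qed.

End Spheres.

(** The cube of dimension [0] is a point with empty boundary: the constant map [x] is a spheroid at
    [y], and a homotopy between it and the constant [y] is a path. *)
Lemma pi0_path_connected (R : realType) (X : topologicalType) :
  (exists x : X, True) -> (forall x0 : X, @pi_trivial R X 0 x0) ->
  path_connected R X.
Proof.
move=> X0 piX; split=> // x y.
have [|H [cH H0 H1 _]] := piX y (fun=> x).
  by split=> [z|z [_ [[]]]//]; exact: cvg_cst.
have c0 : @cube R 0 0 by case.
exists (fun t => H (0, t)); split; last 2 first.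
- exact: H0.
- exact: H1.
apply: (within_continuous_comp_sub _ _ cH).
  apply: continuous_subspaceT => t.
  by apply: (@cvg_pair _ _ _ _ (nbhs (0 : 'rV[R]_0)) (nbhs t)); [exact: cvg_cst|].
by move=> t t01; split.
Qed.

Lemma path_connected_connected (R : realType) (X : topologicalType) :
  path_connected R X -> connected [set: X].
Proof.
move=> [[x _] pX]; have /choice[f fP] := pX x.
have -> : [set: X] = \bigcup_y (f y @` `[0, 1]).
  rewrite predeqE => y; split=> // _; exists y => //.
  by have [_ _ fy] := fP y; exists 1 => //=; rewrite in_itv /= ler01 lexx.
apply: bigcup_connected.
  exists x => y _; have [_ f0 _] := fP y; exists 0 => //=.
  by rewrite in_itv /= lexx ler01.
move=> y _; have [cf _ _] := fP y.
by apply: connected_continuous_connected cf; exact: segment_connected.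
Qed.

(** * Connectivity of the Morse complex *)

Theorem theorem4p3 (R : realType) (T : finType) (G : complex T)
    (Ggraph : is_graph G) (Gedge : (0 < nb_edges G)%N) :
  let E := nb_edges G in
  let d := max_hasse_degree G in
  let M : topologicalType := realization R (morse_complex G) in
  [/\ n_connected R M (Num.ceil (E%:R / d%:R : rat) - 2),
      (d < E)%N -> connected [set: M],
      (2 * d < E)%N -> simply_connected R M &
      forall m : nat, (1 <= m)%N -> (m * d < E)%N -> n_connected R M (m%:Z - 1)].
Proof.
move=> E d M.
have nonempty : exists x : M, True.
  have [|z Mz] := @extensive_nonempty R _ (realization R (morse_complex G)).
    by apply: extensive_morse.
  by exists (exist _ z (mem_set Mz)).
have pi_trivial_morse k (x0 : M) : (k.+1 * d < E)%N -> @pi_trivial R M k x0.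
  by move=> kE; apply: extensive_pi_trivial; apply: extensive_morse.
have morse_path_connected : (d < E)%N -> path_connected R M.
  move=> dE; apply: pi0_path_connected => // x0.
  by apply: pi_trivial_morse; rewrite mul1n.
split.
- split=> // k kE x0; apply: pi_trivial_morse.
  (* An integer is below the ceiling of the quotient exactly when it is below the quotient
     itself. *)
  have : (k.+1%:Z < Num.ceil (E%:R / d%:R : rat)) by lia.
  rewrite real_ceil_gt_int ?num_real//.
  (* For [d = 0] the goal reduces to the existence of an edge. *)
  have [d0|d0] := posnP d; first by rewrite d0 muln0.
  by rewrite ltr_pdivlMr ?ltr0n// -natrM ltr_nat.
- by move=> dE; exact/path_connected_connected/morse_path_connected.
- move=> dE; split=> [|x0]; last exact: pi_trivial_morse.
  by apply: morse_path_connected; lia.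
- move=> m m1 mE; split=> // k km x0; apply: pi_trivial_morse.
  by apply: leq_ltn_trans mE; rewrite leq_mul2r; apply/orP; right; lia.
Qed.
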